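(* Let $\mathsf{s}=\mathrm{diag}(1,0,\ldots,0)\in\mathfrak{gl}_n(\mathbb{C})$ and let $h:[n]\to[n]$ be a Hessenberg function. The minimal semisimple matrix Hessenberg scheme $\mathcal{Y}_{\mathsf{s},h}$ is equidimensional if and only if all of the corners of the associated diagram of $h$ lie on the same subdiagonal; in other words, $\mathcal{Y}_{\mathsf{s},h}$ is equidimensional if and only if $h(i)-i=h(j)-j$ for all distinct corners $i$ and $j$ of $h$.
   Context: Let $[n]=\{1,\dots,n\}$. A Hessenberg function is a map $h:[n]\to[n]$ with $h(i)\ge i$ for all $i$ and $h(i-1)\le h(i)$ for $2\le i\le n$; by convention $h(0)=0$. An index $i\in[n]$ is a corner of $h$ if $h(i)>h(i-1)$. The diagram of $h$ is the lattice path in an $n\times n$ grid from the upper left to the lower right corner whose horizontal step in column $i$ occurs $h(i)$ rows from the top; a corner $i$ corresponds to the corner box $(h(i),i)$ (row $h(i)$, column $i$). A subdiagonal is the set of boxes $(a,b)$ with $a-b$ equal to a fixed constant. Let $\mathbf z=\{z_{ij}\}_{1\le i,j\le n}$ be variables and $Z=(z_{ij})$ the generic matrix with columns $v_1,\dots,v_n$. For $i\in[n]$ with $h(i)<n$, let $\mathcal{I}_{\mathsf{s},h,i}\subseteq\mathbb{C}[\mathbf z]$ be the ideal generated by all $(h(i)+1)\times(h(i)+1)$ minors of the $n\times(i+h(i))$ matrix $[\mathsf{s}v_1\,|\cdots|\,\mathsf{s}v_i\,|\,v_1\,|\cdots|\,v_{h(i)}]$; if $h(i)=n$, $\mathcal{I}_{\mathsf{s},h,i}=0$.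 Put $\mathcal{I}_{\mathsf{s},h}=\sum_{i\in[n]}\mathcal{I}_{\mathsf{s},h,i}$. Let $d=\det(Z)$ and let $\tilde{\mathcal{I}}_{\mathsf{s},h}$ be the preimage in $\mathbb{C}[\mathbf z]$ of the ideal generated by $\mathcal{I}_{\mathsf{s},h}$ in $\mathbb{C}[\mathbf z,d^{-1}]$. The matrix Hessenberg scheme is $\mathcal{Y}_{\mathsf{s},h}=\mathrm{Spec}(\mathbb{C}[\mathbf z]/\tilde{\mathcal{I}}_{\mathsf{s},h})$. Equidimensional means that all irreducible components have the same dimension. *)

(* Defs.v *)
From HB Require Import structures.
From mathcomp Require Import all_boot all_order all_algebra.
From mathcomp Require Import complex spectral.
From mathcomp Require Import boolp classical_sets reals ereal topology.
(* mpoly and topology declare incompatible grammar levels, so mpoly is imported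
   without its notations. *)
From mathcomp Require Import -(notations) mpoly.

Set Implicit Arguments.
Unset Strict Implicit.
Unset Printing Implicit Defensive.

Import Order.TTheory GRing.Theory Num.Theory.

Local Open Scope classical_set_scope.
Local Open Scope ring_scope.

Section TopologicalDimension.
Variable T : topologicalType.
Implicit Types A B : set T.

Definition irreducible A : Prop :=
  A !=set0 /\
  forall F G : set T, closed F -> closed G -> A `<=` F `|` G ->
    A `<=` F \/ A `<=` G.

Definition irreducible_component A : Prop :=
  irreducible A /\ forall B, irreducible B -> A `<=` B -> B = A.

Definition irreducible_chain A (k : nat) (F : nat -> set T) : Prop :=
  (forall i, (i <= k)%N -> [/\ closed (F i), irreducible (F i) & F i `<=` A]) /\
  (forall i, (i < k)%N -> F i `<` F i.+1).

(* The Krull dimension of a closed set [A] (for which closed in [A] and closed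
   in [T] agree), as an element of {-oo} U nat U {+oo}. *)
Definition krull_dim (R : realType) A : \bar R :=
  ereal_sup [set (k%:R)%:E | k in [set k | exists F, irreducible_chain A k F]].

(* [R] only serves to express dimensions as extended numbers. *)
Definition equidimensional (R : realType) : Prop :=
  forall A B, irreducible_component A -> irreducible_component B ->
    krull_dim R A = krull_dim R B.

End TopologicalDimension.

Section Spectrum.
Variable A : comNzRingType.

(* The points are bundled directly: the library's type [prime_idealr A] lives
   in a universe too large to carry a topology. *)
Record Spec : Type := PrimeIdeal {
  prime_pred :> A -> bool;
  _ : idealr_closed prime_pred;
  _ : prime_idealr_closed prime_pred }.

Definition zariski_closed (E : set A) : set Spec :=
  [set P : Spec | forall a, E a -> P a].

Definition zariski_open : set_system Spec :=
  [set U | exists E : set A, ~` U = zariski_closed E].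

Lemma Spec_idealr_closed (P : Spec) : idealr_closed P.
Proof. by case: P. Qed.

Lemma Spec_mul (P : Spec) a b : P (a * b) = P a || P b.
Proof.
case: P => P [P0 _ Pc] Pp /=; apply/idP/idP; first exact: Pp.
have mulP c u : P u -> P (c * u).
  by move=> Pu; have := Pc c _ _ Pu P0; rewrite addr0; apply.
by case/orP=> [Pa|Pb]; [rewrite mulrC|]; apply: mulP.
Qed.

Lemma zariski_openT : zariski_open setT.
Proof.
exists [set 1]; rewrite setCT; apply/seteqP; split=> // P /(_ 1 erefl) P1.
by case: (Spec_idealr_closed P) => _ /negP.
Qed.

Lemma zariski_openI : setI_closed zariski_open.
Proof.
move=> U V [E hE] [F hF]; exists [set a * b | a in E & b in F].
rewrite setCI hE hF; apply/seteqP; split=> [P [PE|PF] _ [a Ea [b Fb <-]]|P PEF].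
- by rewrite Spec_mul (PE _ Ea).
- by rewrite Spec_mul (PF _ Fb) orbT.
apply: contrapT => /not_orP[/existsNP[a /not_implyP[Ea /negP aP]]].
move=> /existsNP[b /not_implyP[Fb /negP bP]].
have : P (a * b) by apply: PEF; exists a => //; exists b.
by rewrite Spec_mul (negPf aP) (negPf bP).
Qed.

Lemma zariski_open_bigU (I : Type) (f : I -> set Spec) :
  (forall i, zariski_open (f i)) -> zariski_open (\bigcup_i f i).
Proof.
move=> fop; exists [set a | exists i (E : set A),
  ~` f i = zariski_closed E /\ E a].
apply/seteqP; split=> [P nfP a [i [E [fE Ea]]]|P PE [i _ fiP]].
  have : (~` f i) P by move=> fiP; apply: nfP; exists i.
  by rewrite fE; apply.
have [E fE] := fop i.
suff : (~` f i) P by [].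
by rewrite fE => a Ea; apply: PE; exists i, E.
Qed.

HB.instance Definition _ := gen_eqMixin Spec.
HB.instance Definition _ := gen_choiceMixin Spec.
HB.instance Definition _ := isOpenTopological.Build Spec
  zariski_openT zariski_openI zariski_open_bigU.

End Spectrum.

(* The ideal generated by [S] in a subring [B] of [L]. *)
Definition ideal_generated (L : comNzRingType) (B S : set L) : set L :=
  [set x | exists s : seq (L * L),
     (forall y, y \in s -> B y.1 /\ S y.2) /\ x = \sum_(y <- s) y.1 * y.2].

(* [A[d^-1]], as a subring of the fraction field. *)
Definition localization (A : idomainType) (d : A) : set {fraction A} :=
  [set x | exists a k, x = tofrac a / tofrac d ^+ k].

(* The preimage in [A] of the ideal generated by [I] in [A[d^-1]]. *)
Definition saturation (A : idomainType) (d : A) (I : set A) : set A :=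
  [set p | ideal_generated (localization d) [set tofrac q | q in I] (tofrac p)].

(* [n] is encoded as 'I_n, so that the value of the function at i is
   (h i).+1 when counted from 1. *)
Record hessenberg (n : nat) := Hessenberg {
  hess_fun :> 'I_n -> 'I_n;
  hess_ge : forall i : 'I_n, (i <= hess_fun i)%N;
  hess_homo : forall i j : 'I_n, i.+1 = j :> nat ->
                (hess_fun i <= hess_fun j)%N }.

(* The first index is always a corner: this is the convention h(0) = 0. *)
Definition corner (n : nat) (h : hessenberg n) (i : 'I_n) : Prop :=
  forall j : 'I_n, j.+1 = i :> nat -> (h j < h i)%N.

Definition corner_box (n : nat) (h : hessenberg n) (i : 'I_n) : 'I_n * 'I_n :=
  (h i, i).

Definition subdiagonal (n : nat) (c : int) : set ('I_n * 'I_n) :=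
  [set b : 'I_n * 'I_n | (b.1 : nat)%:Z - (b.2 : nat)%:Z = c].

Section MatrixHessenbergScheme.
Variables (R : realType) (n : nat).
Local Notation C := (R[i]).
Local Notation Cz := (mpoly (n * n) C).

Definition generic_mx : 'M[Cz]_n :=
  \matrix_(i, j) mpolyX C (mnm1 (mxvec_index i j)).

Variables (s : 'M[C]_n) (h : hessenberg n).

Definition hess_mx (i : 'I_n) : 'M[Cz]_(n, i.+1 + (h i).+1) :=
  row_mx (colsub (widen_ord (ltn_ord i)) (map_mx (@mpolyC (n * n) C) s *m generic_mx))
         (colsub (widen_ord (ltn_ord (h i))) generic_mx).

Definition hess_minors (i : 'I_n) : set Cz :=
  [set m | exists (f : 'I_(h i).+2 -> 'I_n)
                  (g : 'I_(h i).+2 -> 'I_(i.+1 + (h i).+1)),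
     [/\ {homo f : a b / (a < b)%N}, {homo g : a b / (a < b)%N}
       & m = \det (mxsub f g (hess_mx i))]].

Definition hess_ideal_at (i : 'I_n) : set Cz :=
  if ((h i).+1 < n)%N then ideal_generated setT (hess_minors i) else [set 0].

Definition hess_ideal : set Cz :=
  [set p | exists q : 'I_n -> Cz,
     (forall i, hess_ideal_at i (q i)) /\ p = \sum_i q i].

Definition hess_sat_ideal : {pred Cz} :=
  [pred p : Cz | `[< saturation (\det generic_mx) hess_ideal p >]].

(* Properness: at a flag triangularizing [s] all the minors vanish. *)

Local Definition ev (g : 'M[C]_n) : Cz -> C :=
  meval (fun k => mxvec g 0 k).

Local Fact ev0 g : ev g 0 = 0. Proof. exact: meval0. Qed.
Local Fact evD g p q : ev g (p + q) = ev g p + ev g q. Proof. exact: mevalD. Qed.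
Local Fact evM g p q : ev g (p * q) = ev g p * ev g q. Proof. exact: mevalM. Qed.
Local Fact evX g p k : ev g (p ^+ k) = ev g p ^+ k. Proof. exact: rmorphXn. Qed.

Local Fact det_ev (g : 'M[C]_n) m (M : 'M[Cz]_m) : ev g (\det M) = \det (map_mx (ev g) M).
Proof. exact: esym (det_map_mx (meval (fun k => mxvec g 0 k)) M). Qed.

Local Fact ev_generic (g : 'M[C]_n) : map_mx (ev g) generic_mx = g.
Proof. by apply/matrixP=> i j; rewrite !mxE /ev mevalXU mxvecE. Qed.

Local Fact ev_minor (g T : 'M[C]_n) i m : s *m g = g *m T ->
  (forall a b : 'I_n, (b < a)%N -> T a b = 0) ->
  hess_minors i m -> ev g m = 0.
Proof.
move=> sg Tup [f [k [_ _ ->]]].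
pose w := widen_ord (ltn_ord (h i)); pose w' := widen_ord (ltn_ord i).
pose V := colsub w g.
pose W : 'M_((h i).+1, i.+1 + (h i).+1) := row_mx (mxsub w w' T) 1%:M.
have evC : map_mx (ev g) (map_mx (@mpolyC (n * n) C) s) = s.
  by apply/matrixP=> a b; rewrite !mxE /ev mevalC.
have evH : map_mx (ev g) (hess_mx i) = V *m W.
  rewrite /hess_mx map_row_mx !map_mxsub map_mxM evC ev_generic mul_mx_row.
  rewrite mulmx1 sg; congr row_mx; apply/matrixP=> a b; rewrite !mxE.
  rewrite (bigID (fun c : 'I_n => (c < (h i).+1)%N)) /= addrC big1 ?add0r; last first.
    move=> c; rewrite -leqNgt => ltc; rewrite Tup ?mulr0 //=.
    by apply: leq_trans ltc; rewrite ltnS (leq_trans _ (hess_ge h i)) // -ltnS.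
  rewrite (big_ord_narrow (ltn_ord (h i))) /=.
  by apply: eq_bigr => c _; rewrite !mxE.
rewrite det_ev map_mxsub evH mxsub_mul.
apply/eqP/negPn/negP; rewrite -unitfE -unitmxE -row_free_unit => /eqP rk.
by have := mulmx_max_rank (rowsub f V) (colsub k W); rewrite rk ltnn.
Qed.

Local Fact ev_ideal (g T : 'M[C]_n) p : s *m g = g *m T ->
  (forall a b : 'I_n, (b < a)%N -> T a b = 0) ->
  hess_ideal p -> ev g p = 0.
Proof.
move=> sg Tup [q [hq ->]].
rewrite (big_morph _ (evD g) (ev0 g)) big1 // => i _.
have := hq i; rewrite /hess_ideal_at; case: ifP => _ => [[t [ht ->]]|->]; last exact: ev0.
rewrite (big_morph _ (evD g) (ev0 g)) big_seq big1 // => y /ht[_ hy].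
by rewrite evM (ev_minor sg Tup hy) mulr0.
Qed.

Local Fact triangularize : exists g T : 'M[C]_n, [/\ g \in unitmx, s *m g = g *m T &
  (forall a b : 'I_n, (b < a)%N -> T a b = 0)].
Proof.
have [n0|n_gt0] := posnP n.
  exists 1%:M, s; split=> [||a]; rewrite ?unitmx1 ?mul1mx ?mulmx1 //.
  by have := leq_ltn_trans (leq0n a) (ltn_ord a); rewrite [X in (_ < X)%N]n0.
have [P /unitarymx_unit Pu Ptrig] := Schur s^T n_gt0.
exists P^T, (conjmx P s^T)^T; split.
- by rewrite unitmx_tr.
- rewrite -trmx_mul conjumx // -[s in LHS]trmxK -trmx_mul; congr trmx.
  by rewrite mulmxKV.
- by move=> a b ltba; rewrite mxE; have /is_trig_mxP -> := Ptrig.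
Qed.

Local Fact clear_denominators (g T : 'M[C]_n) x : s *m g = g *m T ->
  (forall a b : 'I_n, (b < a)%N -> T a b = 0) -> \det generic_mx != 0 ->
  ideal_generated (localization (\det generic_mx))
    [set tofrac q | q in hess_ideal] x ->
  exists k a, tofrac (\det generic_mx) ^+ k * x = tofrac a /\ ev g a = 0.
Proof.
move=> sg Tup d0 [t [ht ->]].
elim: t ht => [|[u v] t IHt] ht.
  by exists 0, 0; rewrite big_nil mulr0 rmorph0 ev0.
have [y yt|k [a [ka a0]]] := IHt; first by apply: ht; rewrite inE yt orbT.
have [/= [b [l ->]] [q hq <-]] := ht _ (mem_head _ _).
exists (k + l)%N, (\det generic_mx ^+ k * (b * q) + \det generic_mx ^+ l * a).
split; last first.
  by rewrite evD !evM a0 (ev_ideal sg Tup hq) !mulr0 addr0.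
rewrite big_cons /= mulrDr rmorphD !rmorphM !rmorphXn /= -ka.
congr (_ + _); last by rewrite mulrA -exprD addnC.
rewrite exprD -mulrA; congr (_ * _); rewrite mulrA; congr (_ * _).
by rewrite mulrC divfK // expf_neq0 // tofrac_eq0.
Qed.

Lemma hess_sat_ideal_closed : idealr_closed hess_sat_ideal.
Proof.
have [g [T [gu sg Tup]]] := triangularize.
have evd : ev g (\det generic_mx) = \det g by rewrite det_ev ev_generic.
have dg : \det g != 0 by rewrite -unitfE -unitmxE.
have d0 : \det generic_mx != 0.
  by apply: contraNneq dg => d0; rewrite -evd d0 ev0.
split.
- by apply/asboolP; exists [::]; rewrite big_nil rmorph0; split.
- apply/asboolP=> /(clear_denominators sg Tup d0)[k [a [ka a0]]].
  have : ev g (\det generic_mx ^+ k) = 0.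
    by rewrite -a0; congr ev; apply/eqP; rewrite -tofrac_eq rmorphXn -ka rmorph1 mulr1.
  by rewrite evX evd => /eqP; rewrite expf_eq0 (negPf dg) andbF.
move=> a u v /asboolP[t1 [h1 e1]] /asboolP[t2 [h2 e2]]; apply/asboolP.
exists ([seq (tofrac a * y.1, y.2) | y <- t1] ++ t2); split.
  move=> y; rewrite mem_cat => /orP[/mapP[x /h1[[b [k ->]] xI] ->]|/h2 //].
  by split=> //; exists (a * b), k; rewrite rmorphM mulrA.
rewrite rmorphD rmorphM /= e1 e2 big_cat big_map mulr_sumr /=; congr (_ + _).
by apply: eq_bigr => x _; rewrite mulrA.
Qed.

HB.instance Definition _ := isIdealr.Build Cz hess_sat_ideal hess_sat_ideal_closed.

Definition matrix_hessenberg_scheme : topologicalType :=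
  Spec {ideal_quot hess_sat_ideal}.

End MatrixHessenbergScheme.

Definition minimal_semisimple (R : realType) (n : nat) : 'M[R[i]]_n :=
  diag_mx (\row_(j < n) (j == 0%N :> nat)%:R).

(* Main.v *)
(* Index rows and columns from 0 and let a be the first row of an invertible
   matrix g and w the first column of its inverse, so that a w = 1.  The minors
   vanish at g iff a_j w_k = 0 whenever j <= i and h(i) < k for some i.  If p is
   the first index with a_p <> 0, this says that g lies in the stratum
   S_p = {a_j = 0 for j < p, w_k = 0 for k > h(p)}, where p may be replaced by the
   corner with the same value of h.  The points of S_p with w_0 <> 0 are exactly
   the invertible matrices with a_j = 0 for j < p whose first column, below row 0,
   is a combination of the columns 1, ..., h(p), so they form an open subset of an
   affine space, with the coefficients of the combination as coordinates in place
   of the first column.  This chart is the ring morphism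
   [chart_mor]; its kernel is the prime P_p of the closure of S_p.  Every prime
   over the saturated ideal contains some P_p with p a corner, and these P_p are
   pairwise incomparable, so they define the irreducible components.

   The dimension of P_p is the number N_p = n^2 - p - (n - 1 - h(p)) of coordinates of
   the chart: killing the coordinates one at a time at the identity matrix gives a
   chain of N_p primes over P_p, and a chain of length k over P_p forces the growth
   m^k of linearly independent families of degree O(m), so that k <= N_p. *)
Require Import Defs.
From HB Require Import structures.
From mathcomp Require Import all_boot all_order all_algebra.
From mathcomp Require Import complex ring_quotient.
From mathcomp Require Import boolp classical_sets reals ereal topology.
From mathcomp Require Import -(notations) mpoly.
Set Implicit Arguments.
Unset Strict Implicit.
Unset Printing Implicit Defensive.
Import Order.TTheory GRing.Theory Num.Theory.
Local Open Scope classical_set_scope.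
Local Open Scope ring_scope.
Local Open Scope quotient_scope.

(** * Prime spectra: irreducible closed sets, components and dimension *)

Section SpecTheory.
Variable A : comNzRingType.
Implicit Types P Q : Spec A.

Lemma Spec_prime P : prime_idealr_closed P.
Proof. by case: P. Qed.

Lemma Spec0 P : P 0.
Proof. by case: (Spec_idealr_closed P). Qed.

Lemma Spec1 P : P 1 = false.
Proof. by case: (Spec_idealr_closed P) => _ /negbTE. Qed.

Lemma SpecMl P a u : P u -> P (a * u).
Proof. by rewrite Spec_mul => ->; rewrite orbT. Qed.

Lemma SpecD P u v : P u -> P v -> P (u + v).
Proof.
by move=> Pu Pv; case: (Spec_idealr_closed P) => _ _ /(_ 1 u v Pu Pv); rewrite mul1r.
Qed.

Definition prime_le P Q : Prop := forall a, P a -> Q a.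

Lemma prime_le_trans P Q S : prime_le P Q -> prime_le Q S -> prime_le P S.
Proof. by move=> PQ QS a /PQ/QS. Qed.

Definition Vspec P : set (Spec A) := [set Q | prime_le P Q].

Lemma Vspec_closed P : closed (Vspec P).
Proof.
rewrite -openC; exists [set a | P a]; rewrite setCK.
by apply/seteqP; split=> Q PQ a; apply: PQ.
Qed.

Lemma closed_zariski (F : set (Spec A)) : closed F -> exists E, F = zariski_closed E.
Proof. by rewrite -openC => -[E]; rewrite setCK; exists E. Qed.

Lemma closed_Vspec (F : set (Spec A)) P : closed F -> F P -> Vspec P `<=` F.
Proof.
move=> /closed_zariski[E ->] FP Q PQ a Ea; exact: PQ (FP a Ea).
Qed.

Lemma Vspec_irreducible P : irreducible (Vspec P).
Proof.
split; first by exists P.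
move=> F G Fc Gc sub; have : Vspec P P by [].
by move=> /sub[/(closed_Vspec Fc)|/(closed_Vspec Gc)]; [left|right].
Qed.

(** The prime is the intersection of all points of [F]. When it contains [u * v], the closed loci of
    [u] and of [v] cover [F], and irreducibility puts [F] inside one of them. *)
Lemma irreducible_prime (F : set (Spec A)) : irreducible F ->
  exists P, forall a, P a <-> forall Q, F Q -> Q a.
Proof.
move=> [[Q0 FQ0] irrF].
pose p : A -> bool := fun a => `[< forall Q, F Q -> Q a >].
have pP a : p a <-> forall Q, F Q -> Q a by split=> /asboolP.
have clp : idealr_closed p.
  split.
  - by apply/pP => Q _; exact: Spec0.
  - by apply/negP => /pP/(_ Q0 FQ0); rewrite Spec1.
  - move=> a u v /pP pu /pP pv; apply/pP => Q FQ.
    by apply: SpecD; [apply: SpecMl; exact: pu|exact: pv].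
have prp : prime_idealr_closed p.
  move=> u v /pP puv.
  have cl w : closed [set Q : Spec A | Q w].
    rewrite -openC; exists [set w]; rewrite setCK.
    by apply/seteqP; split=> Q /=; [move=> Qw _ ->|apply].
  have sub : F `<=` [set Q : Spec A | Q u] `|` [set Q : Spec A | Q v].
    by move=> Q /puv; rewrite Spec_mul => /orP.
  by have [s|s] := irrF _ _ (cl u) (cl v) sub; apply/orP; [left|right]; apply/pP.
by exists (PrimeIdeal clp prp).
Qed.

Lemma irreducible_sub_Vspec (F : set (Spec A)) P :
  (forall a, P a <-> forall Q, F Q -> Q a) -> F `<=` Vspec P.
Proof. by move=> PF Q FQ a /PF; apply. Qed.

Lemma closed_irreducible (F : set (Spec A)) : closed F -> irreducible F ->
  exists P, F = Vspec P.
Proof.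
move=> Fc /irreducible_prime[P PF]; exists P; apply/seteqP; split.
  exact: irreducible_sub_Vspec.
apply: closed_Vspec => //; have [E FE] := closed_zariski Fc.
by rewrite FE => a Ea; apply/PF => Q; rewrite FE; apply.
Qed.

Lemma VspecS P Q : Vspec P `<=` Vspec Q <-> prime_le Q P.
Proof. by split=> [sub|QP T PT a /QP/PT//]; apply: sub. Qed.

Definition prime_lt P Q : Prop := prime_le P Q /\ exists2 a, Q a & ~~ P a.

Lemma prime_lt_Vspec P Q : prime_lt P Q <-> Vspec Q `<` Vspec P.
Proof.
split=> [[PQ [a Qa nPa]]|[/VspecS PQ nQP]]; split=> //; first exact/VspecS.
  by move=> /VspecS/(_ a Qa); rewrite (negPf nPa).
apply: contrapT => nex; apply: nQP; apply/VspecS => a Qa.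
by apply: contrapT => /negP nPa; apply: nex; exists a.
Qed.

Definition prime_chain (k : nat) (Q : nat -> Spec A) :=
  forall i, (i < k)%N -> prime_lt (Q i) (Q i.+1).

Lemma prime_chain_le k (Q : nat -> Spec A) i : prime_chain k Q -> (i <= k)%N -> prime_le (Q 0%N) (Q i).
Proof.
move=> ch; elim: i => [|i IH] lik //.
by apply: prime_le_trans (ch i lik).1; apply: IH; exact: ltnW.
Qed.

(* Reversing the order turns a chain of irreducible closed sets into a chain
   of primes. *)
Lemma irreducible_chain_primes P k F : irreducible_chain (Vspec P) k F ->
  exists2 Q : nat -> Spec A, prime_chain k Q & prime_le P (Q 0%N).
Proof.
move=> [Fi Fs].
have /choice[Q QP] : forall i, exists Q : Spec A, (i <= k)%N -> F (k - i)%N = Vspec Q.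
  move=> i; case: (leqP i k) => [lik|]; last by exists P.
  by have [/closed_irreducible H /H[Q ?] _] := Fi _ (leq_subr i k); exists Q.
exists Q => [i lik|].
  have := Fs (k - i.+1)%N; rewrite -subSn // subSS (QP i (ltnW lik)) (QP _ lik).
  by move=> H; apply/prime_lt_Vspec/H; exact: leq_subr.
apply/VspecS; rewrite -QP //.
by have [_ _] := Fi _ (leq_subr 0 k).
Qed.

Lemma primes_irreducible_chain P k (Q : nat -> Spec A) : prime_chain k Q -> prime_le P (Q 0%N) ->
  exists F, irreducible_chain (Vspec P) k F.
Proof.
move=> ch PQ; exists (fun i => Vspec (Q (k - i)%N)); split=> i lik.
  split; [exact: Vspec_closed|exact: Vspec_irreducible|].
  by apply/VspecS; apply: prime_le_trans PQ _; apply: prime_chain_le ch (leq_subr _ _).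
apply/prime_lt_Vspec; have := ch (k - i.+1)%N.
by rewrite -subSn // subSS; apply; exact: leq_subr.
Qed.

Lemma krull_dim_Vspec (R : realType) P N :
  (forall k (Q : nat -> Spec A), prime_chain k Q -> prime_le P (Q 0%N) -> (k <= N)%N) ->
  (exists2 Q : nat -> Spec A, prime_chain N Q & prime_le P (Q 0%N)) ->
  krull_dim R (Vspec P) = N%:R%:E.
Proof.
move=> ub [Q ch PQ]; apply/eqP; rewrite eq_le; apply/andP; split.
  apply: ge_ereal_sup => _ [k [F /irreducible_chain_primes[Q' ch' PQ']] <-].
  by rewrite lee_fin ler_nat; apply: ub ch' PQ'.
apply: ereal_sup_ubound; exists N => //.
exact: primes_irreducible_chain ch PQ.
Qed.

Section Components.
Variables (I : Type) (P : I -> Spec A).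
Hypothesis Pmin : forall Q, exists i, prime_le (P i) Q.

(** If [Q] is the intersection of the points of [F], then [F] lies in [Vspec Q], hence in some
    [Vspec (P i)]; maximality of [F] turns this inclusion into equality. *)
Lemma irreducible_component_Vspec (F : set (Spec A)) :
  irreducible_component F -> exists i, F = Vspec (P i).
Proof.
move=> [/irreducible_prime[Q QF] Fmax]; have [i PQ] := Pmin Q; exists i.
apply/esym/Fmax; first exact: Vspec_irreducible.
apply: subset_trans (irreducible_sub_Vspec QF) _; exact/VspecS.
Qed.

Hypothesis Pincomp : forall i j, prime_le (P i) (P j) -> i = j.

Lemma Vspec_irreducible_component i : irreducible_component (Vspec (P i)).
Proof.
split=> [|F Firr PF]; first exact: Vspec_irreducible.
have [Q QF] := irreducible_prime Firr; have FQ := irreducible_sub_Vspec QF.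
have [j jQ] := Pmin Q.
have ji : j = i.
  apply: Pincomp; apply: prime_le_trans jQ _.
  by apply/VspecS; exact: subset_trans FQ.
apply/seteqP; split=> //; rewrite -ji.
by apply: subset_trans FQ _; apply/VspecS.
Qed.

Lemma equidimensional_primes (R : realType) (N : I -> nat) :
  (forall i, krull_dim R (Vspec (P i)) = (N i)%:R%:E) ->
  equidimensional (Spec A) R <-> forall i j, N i = N j.
Proof.
move=> dimN; split=> [eqd i j|eqN F G].
  have := eqd _ _ (Vspec_irreducible_component i) (Vspec_irreducible_component j).
  by rewrite !dimN => -[] /eqP; rewrite eqr_nat => /eqP.
by move=> /irreducible_component_Vspec[i ->] /irreducible_component_Vspec[j ->];
  rewrite !dimN (eqN i j).
Qed.

End Components.
End SpecTheory.

(** * Transport of primes along a ring morphism, possibly with a set-theoretic section *)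

Section Pullback.
Variables (A B : comNzRingType) (f : {rmorphism A -> B}).

Lemma pullback_spec (Q : Spec B) : exists P : Spec A, forall a, P a = Q (f a).
Proof.
have id : idealr_closed (fun a => Q (f a)).
  split; rewrite /in_mem /= ?rmorph0 ?rmorph1 ?Spec0 ?Spec1 //.
  move=> a u v; rewrite /in_mem /= rmorphD rmorphM => Qu Qv.
  by apply: SpecD => //; apply: SpecMl.
have pr : prime_idealr_closed (fun a => Q (f a)).
  by move=> u v; rewrite /in_mem /= rmorphM Spec_mul.
by exists (PrimeIdeal id pr).
Qed.

Lemma kernel_spec : prime_idealr_closed (fun b : B => b == 0) ->
  exists P : Spec A, forall a, P a = (f a == 0).
Proof.
move=> dom.
have id : idealr_closed (fun b : B => b == 0).
  split; rewrite /in_mem /= ?eqxx ?oner_eq0 //.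
  by move=> a u v /eqP -> /eqP ->; rewrite mulr0 addr0.
exact: (pullback_spec (PrimeIdeal id dom)).
Qed.

(** [g] only picks representatives. As [P] contains the kernel of [f], membership in [P] does not
    depend on the representative. *)
Lemma push_spec (P : Spec A) (g : B -> A) : cancel g f ->
  (forall a, f a = 0 -> P a) -> exists Q : Spec B, forall a, Q (f a) = P a.
Proof.
move=> gK kerP.
have Pf a b : f a = f b -> P a = P b.
  have half x y : f x = f y -> P x -> P y.
    move=> fxy Px; rewrite -[y](addrNK x); apply: SpecD => //.
    by apply: kerP; rewrite rmorphB fxy subrr.
  by move=> fab; apply/idP/idP; apply: half.
pose q b := P (g b).
have qf a : q (f a) = P a by apply: Pf; rewrite gK.
have id : idealr_closed q.
  split; rewrite /in_mem /=.
  - by rewrite -(rmorph0 f) qf Spec0.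
  - by rewrite -(rmorph1 f) qf Spec1.
  move=> a u v Pu Pv; rewrite -[a]gK -[u]gK -[v]gK -rmorphM -rmorphD qf.
  by apply: SpecD => //; apply: SpecMl.
have pr : prime_idealr_closed q.
  move=> u v; rewrite /in_mem /= -[u]gK -[v]gK -rmorphM !qf.
  by rewrite Spec_mul.
by exists (PrimeIdeal id pr).
Qed.

Lemma pullback_chain k (Q : nat -> Spec B) (g : B -> A) : cancel g f ->
  prime_chain k Q -> exists2 Q' : nat -> Spec A,
    prime_chain k Q' & forall i a, Q' i a = Q i (f a).
Proof.
move=> gK ch; have /choice[Q' Q'E] := fun i => pullback_spec (Q i).
exists Q' => // i ik; have [le [b Qb nQb]] := ch i ik; split=> [a|].
  by rewrite !Q'E; exact: le.
by exists (g b); rewrite Q'E gK.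
Qed.

Lemma push_chain k (Q : nat -> Spec A) (g : B -> A) : cancel g f ->
  prime_chain k Q -> (forall a, f a = 0 -> Q 0%N a) -> exists2 Q' : nat -> Spec B,
    prime_chain k Q' & forall a, Q' 0%N (f a) = Q 0%N a.
Proof.
move=> gK ch kerQ.
have /choice[Q' Q'E] : forall i, exists Q' : Spec B, (i <= k)%N ->
    forall a, Q' (f a) = Q i a.
  move=> i; case: (leqP i k) => [ik|]; last first.
    by have [Q' _] := push_spec gK kerQ; exists Q'.
  have [a fa0|Q' Q'E] := push_spec (P := Q i) gK; last by exists Q'.
  exact: (prime_chain_le ch ik (kerQ a fa0)).
exists Q' => [i ik|a]; last exact: Q'E.
have [le [a Qa nQa]] := ch i ik; split=> [b|].
  by rewrite -[b]gK Q'E ?(ltnW ik) // Q'E //; exact: le.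
by exists (f a); rewrite Q'E // ltnW.
Qed.

End Pullback.

(** * Primes that contain an ideal and avoid a multiplicative set *)

Section PrimeAvoidance.
Variables (A : comNzRingType) (I S : set A).
Hypothesis I0 : I 0.
Hypothesis ID : forall u v, I u -> I v -> I (u + v).
Hypothesis IM : forall a u, I u -> I (a * u).
Hypothesis S1 : S 1.
Hypothesis SM : forall s t, S s -> S t -> S (s * t).
Hypothesis IS : forall x, I x -> ~ S x.

Lemma exists_prime_avoiding :
  exists Q : Spec A, (forall x, I x -> Q x) /\ forall x, Q x -> ~ S x.
Proof.
pose good (X : set A) := [/\ forall u v, X u -> X v -> X (u + v),
  forall a u, X u -> X (a * u), forall x, X x -> ~ S x
  & X !=set0 -> I `<=` X].
have [F Fgood tot|J [[JD JM JS JI] Jmax]] := @Zorn_bigcup A good.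
  split.
  - move=> u v [X FX Xu] [Y FY Yv].
    by have [s|s] := tot _ _ FX FY; [exists Y|exists X] => //;
      [have [D _ _ _] := Fgood _ FY|have [D _ _ _] := Fgood _ FX];
      apply: D => //; exact: s.
  - by move=> a u [X FX Xu]; have [_ M _ _] := Fgood _ FX; exists X => //; exact: M.
  - by move=> x [X FX Xx]; have [_ _ D _] := Fgood _ FX; exact: D.
  - move=> [x [X FX Xx]] y Iy; exists X => //; have [_ _ _] := Fgood _ FX.
    by apply => //; exists x.
have Jne : J !=set0.
  apply: contrapT => J0; apply: (Jmax I); last exact: (And4 ID IM IS (fun _ => @subset_refl _ I)).
  split=> [x Jx|IJ]; first by case: J0; exists x.
  by apply: J0; exists 0; apply: IJ.
have IJ := JI Jne; have J0 := IJ _ I0.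
have J1 : ~ J 1 by move=> /JS.
(* For [u] outside [J] the ideal generated by [J] and [u] is strictly larger, so by maximality it
   meets [S]. *)
have meet u : ~ J u -> exists2 b, J b & exists c, S (b + c * u).
  move=> nJu; apply: contrapT => nS.
  pose X := [set x | exists2 b, J b & exists c, x = b + c * u].
  have JX : J `<=` X by move=> x Jx; exists x => //; exists 0; rewrite mul0r addr0.
  apply: (Jmax X).
    split=> // XJ; apply: nJu; apply: XJ; exists 0 => //.
    by exists 1; rewrite mul1r add0r.
  split.
  - move=> _ _ [b Jb [c ->]] [b' Jb' [c' ->]]; exists (b + b'); first exact: JD.
    by exists (c + c'); rewrite mulrDl addrACA.
  - move=> a _ [b Jb [c ->]]; exists (a * b); first exact: JM.
    by exists (a * c); rewrite mulrDr mulrA.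
  - by move=> _ [b Jb [c ->]] Sb; apply: nS; exists b => //; exists c.
  - by move=> _; exact: subset_trans JX.
pose q x : bool := `[< J x >].
have id : idealr_closed q.
  split; first exact/asboolP.
    by apply/negP => /asboolP.
  by move=> a u v /asboolP Ju /asboolP Jv; apply/asboolP/JD => //; exact: JM.
have pr : prime_idealr_closed q.
  move=> u v /asboolP Juv; apply: contrapT => /negP; rewrite negb_or.
  move=> /andP[/asboolPn/meet[b Jb [c Sb]] /asboolPn/meet[b' Jb' [c' Sb']]].
  apply: JS (SM Sb Sb'); rewrite mulrDr !mulrDl.
  have -> : c * u * (c' * v) = (c * c') * (u * v) by rewrite mulrACA.
  have JM' x y : J x -> J (x * y) by rewrite mulrC; exact: (JM).
  by apply: (JD); apply: (JD); [exact: JM'|exact: (JM)|exact: JM'|exact: (JM)].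
exists (PrimeIdeal id pr); split=> x; first by move=> Ix; apply/asboolP/IJ.
by move=> /asboolP; exact: JS.
Qed.

End PrimeAvoidance.

(** * Residue fields of primes *)

Section ResidueField.
Variables (A : comNzRingType) (Q : Spec A).

Definition residue_ideal : {pred A} := [pred a | Q a].

HB.instance Definition _ :=
  isIdealr.Build A residue_ideal (Spec_idealr_closed Q).
HB.instance Definition _ :=
  isPrimeIdealrClosed.Build A residue_ideal (@Spec_prime _ Q).

Definition residue_dom := {ideal_quot residue_ideal}.
HB.instance Definition _ := GRing.ComNzRing.on residue_dom.

(** Invertibility is decided classically and inverses are picked by choice, which gives the quotient
    the structure needed to form [{fraction residue_dom}]. *)
Definition residue_unit : {pred residue_dom} :=
  [pred x | `[< exists y, y * x = 1 >]].

Definition residue_inv (x : residue_dom) : residue_dom :=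
  if pselect (exists y, y * x = 1) is left e then projT1 (cid e) else x.

Lemma residue_mulVx : {in residue_unit, left_inverse 1 residue_inv *%R}.
Proof.
move=> x /asboolP xu; rewrite /residue_inv; case: pselect => // e.
exact: (projT2 (cid e)).
Qed.

Lemma residue_unitPl x y : y * x = 1 -> residue_unit x.
Proof. by move=> yx; apply/asboolP; exists y. Qed.

Lemma residue_inv_out : {in [predC residue_unit], residue_inv =1 id}.
Proof.
move=> x; rewrite inE => /asboolPn nxu; rewrite /residue_inv.
by case: pselect.
Qed.

HB.instance Definition _ := GRing.ComNzRing_hasMulInverse.Build residue_dom
  residue_mulVx residue_unitPl residue_inv_out.
HB.instance Definition _ := GRing.ComUnitRing_isIntegral.Build residue_dom
  (@Quotient.rquot_IdomainAxiom A residue_ideal).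

Lemma residue_field : exists (K : fieldType) (f : {rmorphism A -> K}),
  forall a, (f a == 0) = Q a.
Proof.
exists {fraction residue_dom}.
pose f : {rmorphism A -> {fraction residue_dom}} :=
  (@tofrac residue_dom \o \pi_(residue_dom))%FUN.
exists f => a; rewrite /= tofrac_eq0.
have -> : (0 : residue_dom) = \pi_(residue_dom) 0 by rewrite rmorph0.
by rewrite -Quotient.idealrBE subr0.
Qed.

End ResidueField.

(** * Evaluation of polynomials in the matrix entries at a matrix *)

(* Locked: otherwise unification unfolds it when comparing two morphisms. *)
HB.lock Definition mxev (C : fieldType) (n : nat) (T : comNzRingType)
    (iota : {rmorphism C -> T}) (g : 'M[T]_n) : {rmorphism mpoly (n * n) C -> T} :=
  mmap iota (fun k => mxvec g 0 k).

Section Evaluation.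
Variables (C : fieldType) (n : nat).
Local Notation Cz := (mpoly (n * n) C).

Definition varmx : 'M[Cz]_n := \matrix_(i, j) mpolyX C (mnm1 (mxvec_index i j)).
Local Notation Z := varmx.

Lemma mpoly_rmorph_ext (T : comNzRingType) (f g : {rmorphism Cz -> T}) :
  (forall c, f (mpolyC _ c) = g (mpolyC _ c)) -> map_mx f Z = map_mx g Z ->
  f =1 g.
Proof.
move=> fgC fgZ p; rewrite (mpolyE p) !rmorph_sum; apply: eq_bigr => m _.
rewrite -mul_mpolyC !rmorphM fgC; congr (_ * _).
rewrite mpolyXE_id !rmorph_prod; apply: eq_bigr => k _.
rewrite !rmorphXn; congr (_ ^+ _).
case/mxvec_indexP: k => i j.
by have /matrixP/(_ i j) := fgZ; rewrite !mxE.
Qed.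

Section Mxev.
Variables (T : comNzRingType) (iota : {rmorphism C -> T}) (g : 'M[T]_n).

Lemma mxevC c : mxev iota g (mpolyC _ c) = iota c.
Proof. by rewrite mxev.unlock; exact: mmapC. Qed.

Lemma mxev_generic : map_mx (mxev iota g) Z = g.
Proof. by apply/matrixP=> i j; rewrite !mxE mxev.unlock /= mmapX mmap1U mxvecE. Qed.

Lemma mxev_det : mxev iota g (\det Z) = \det g.
Proof. by rewrite -[in RHS]mxev_generic det_map_mx. Qed.

End Mxev.

Lemma rmorph_mxev (T : comNzRingType) (iota : {rmorphism C -> T})
    (f : {rmorphism Cz -> T}) (g : 'M[T]_n) :
  (forall c, f (mpolyC _ c) = iota c) -> map_mx f Z = g -> f =1 mxev iota g.
Proof.
move=> fC fZ; apply: mpoly_rmorph_ext => [c|]; first by rewrite mxevC.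
by rewrite mxev_generic.
Qed.

Lemma mxev_comp (T T' : comNzRingType) (iota : {rmorphism C -> T})
    (iota' : {rmorphism C -> T'}) (f : {rmorphism T -> T'}) (g : 'M[T]_n) p :
  (forall c, f (iota c) = iota' c) ->
  f (mxev iota g p) = mxev iota' (map_mx f g) p.
Proof.
move=> fi; apply: (@rmorph_mxev _ iota' (f \o mxev iota g)%FUN).
  by move=> c; rewrite /= mxevC.
by rewrite map_mx_comp mxev_generic.
Qed.

End Evaluation.

(** * Minors and rank *)

Section Minors.
Variable K : fieldType.

Lemma det_mxsub_mulmx_eq0 m1 m2 r (V : 'M[K]_(m1, r)) (W : 'M_(r, m2))
    (f : 'I_r.+1 -> 'I_m1) (g : 'I_r.+1 -> 'I_m2) :
  \det (mxsub f g (V *m W)) = 0.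
Proof.
rewrite mxsub_mul; apply/eqP/negPn/negP.
rewrite -unitfE -unitmxE -row_free_unit => /eqP rk.
by have := mulmx_max_rank (rowsub f V) (colsub g W); rewrite rk ltnn.
Qed.

Lemma homo_enum_val n (A : {set 'I_n}) :
  {homo @enum_val _ (mem A) : i j / (i < j)%N}.
Proof.
move=> i j ij; pose x0 := enum_val i.
rewrite !(enum_val_nth x0) /enum_mem.
have srt : sorted ltn [seq val x | x <- enum A].
  rewrite (subseq_sorted ltn_trans (map_subseq _ (filter_subseq _ _))) //.
  by rewrite -enumT val_enum_ord iota_ltn_sorted.
have szA : size [seq val x | x <- enum A] = #|A| by rewrite size_map cardE.
have := sorted_ltn_nth ltn_trans (val x0) srt i j.
rewrite !inE szA !ltn_ord => /(_ isT isT ij).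
by rewrite !(nth_map x0) // -cardE.
Qed.

(** Rank [m] would provide [m] independent rows. Listed in increasing order they still span
    everything, so the corresponding minor would be nonzero. *)
Lemma increasing_minors_rank n m (X : 'M[K]_(n, m)) :
  (forall f : 'I_m -> 'I_n, {homo f : i j / (i < j)%N} -> \det (rowsub f X) = 0) ->
  (\rank X < m)%N.
Proof.
move=> minors; rewrite ltn_neqAle rank_leq_col andbT; apply/negP => /[dup] fX /eqP rX.
pose f0 := fullrankfun fX.
pose A := finset.imset f0 (mem 'I_m).
have cA : #|A| = m by rewrite card_imset ?card_ord //; exact: fullrankfun_inj.
pose f (i : 'I_m) := enum_val (cast_ord (esym cA) i).
have fhomo : {homo f : i j / (i < j)%N} by move=> i j ij; apply: homo_enum_val.
have := minors f fhomo; apply/eqP; rewrite -unitfE -unitmxE -row_full_unit.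
rewrite -col_leq_rank; apply: leq_trans (mxrankS (_ : rowsub f0 X <= rowsub f X)%MS).
  by have := fullrowsub_full fX; rewrite -col_leq_rank.
apply/row_subP => i; rewrite row_rowsub.
have f0A : f0 i \in A by rewrite imset_f.
have -> : f0 i = f (cast_ord cA (enum_rank_in f0A (f0 i))).
  by rewrite /f cast_ordK enum_rankK_in.
by rewrite -row_rowsub row_sub.
Qed.

End Minors.

(** * The minors as conditions on the first row of a matrix and the first column of its inverse *)

Section HessMatrix.
Variables (n : nat) (h : hessenberg n.+1).

(** The matrix [[s v_0 | ... | s v_i | v_0 | ... | v_(h i)]] for [s = diag(1, 0, ..., 0)]:
    multiplication by [s] keeps row 0 only. *)
Definition hess_block (T : nzRingType) (g : 'M[T]_n.+1) (i : 'I_n.+1) :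
    'M[T]_(n.+1, i.+1 + (h i).+1) :=
  row_mx (\matrix_(a, j) (if a == 0 then g 0 (widen_ord (ltn_ord i) j) else 0))
         (colsub (widen_ord (ltn_ord (h i))) g).

Variable K : fieldType.
Implicit Types (g : 'M[K]_n.+1) (w : 'cV[K]_n.+1).

(** Since [g w = e_0], the column [s v_j] is the sum of the [g_0j w_k v_k], where only [k <= h i]
    survives. So the block factors through the [h i + 1] columns [v_0, ..., v_(h i)], too few for
    minors of size [h i + 2]. *)
Lemma hess_block_minors_eq0 g w i (f : 'I_(h i).+2 -> 'I_n.+1)
    (c : 'I_(h i).+2 -> 'I_(i.+1 + (h i).+1)) :
  g *m w = delta_mx 0 0 ->
  (forall j k : 'I_n.+1, (j <= i)%N -> (h i < k)%N -> g 0 j * w k 0 = 0) ->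
  \det (mxsub f c (hess_block g i)) = 0.
Proof.
move=> gw aw.
pose v := widen_ord (ltn_ord (h i)); pose v' := widen_ord (ltn_ord i).
suff -> : hess_block g i =
    colsub v g *m row_mx (\matrix_(k, j) (w (v k) 0 * g 0 (v' j))) 1%:M.
  exact: det_mxsub_mulmx_eq0.
rewrite mul_mx_row mulmx1; congr row_mx; apply/matrixP => a j; rewrite !mxE.
have /matrixP/(_ a 0) := gw; rewrite !mxE eqxx andbT => gwa.
have -> : (if a == 0 then g 0 (v' j) else 0) = (a == 0)%:R * g 0 (v' j).
  by case: eqP; rewrite ?mul1r ?mul0r.
rewrite -gwa mulr_suml (bigID (fun k : 'I_n.+1 => (k < (h i).+1)%N)) /= addrC big1.
  rewrite add0r (big_ord_narrow (ltn_ord (h i))) /=.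
  by apply: eq_bigr => k _; rewrite !mxE mulrA.
move=> k; rewrite -ltnNge => hk; rewrite -mulrA [w _ _ * _]mulrC aw ?mulr0 //.
by rewrite /= -ltnS.
Qed.

(** The minors on [s v_j, v_0, ..., v_(h i)] yield a linear relation among these columns. The
    inverse of [g] carries it to a relation among [g_0j w] and [e_0, ..., e_(h i)], with [w] the
    first column of the inverse; row [k] sees only the first term. *)
Lemma hess_block_minors g i : g \in unitmx ->
  (forall (f : 'I_(h i).+2 -> 'I_n.+1) (c : 'I_(h i).+2 -> 'I_(i.+1 + (h i).+1)),
    {homo f : a b / (a < b)%N} -> {homo c : a b / (a < b)%N} ->
    \det (mxsub f c (hess_block g i)) = 0) ->
  forall j k : 'I_n.+1, (j <= i)%N -> (h i < k)%N -> g 0 j * invmx g k 0 = 0.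
Proof.
move=> gu minors j k ji hk.
have ji' : (j < i.+1)%N by [].
pose c (l : 'I_(h i).+2) : 'I_(i.+1 + (h i).+1) :=
  if unlift ord0 l is Some l' then rshift i.+1 l' else lshift _ (Ordinal ji').
have chomo : {homo c : a b / (a < b)%N}.
  move=> a b; rewrite /c; case: unliftP => [a'|] ->; case: unliftP => [b'|] -> //=.
    by rewrite ltn_add2l.
  by move=> _; rewrite ltn_addr.
have block0 a : hess_block g i a (c 0) = if a == 0 then g 0 j else 0.
  rewrite /c unlift_none row_mxEl mxE; case: eqP => // _.
  by congr (g _ _); apply: val_inj.
have blockS a l : hess_block g i a (c (lift 0 l)) = g a (widen_ord (ltn_ord (h i)) l).
  by rewrite /c liftK row_mxEr mxE.
have rk := increasing_minors_rank (X := colsub c (hess_block g i)).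
have /rk{rk} : forall f : 'I_(h i).+2 -> 'I_n.+1, {homo f : a b / (a < b)%N} ->
    \det (rowsub f (colsub c (hess_block g i))) = 0.
  by move=> f fh; rewrite -mxsub_comp /=; exact: minors.
set X := colsub c _ => rk.
have : kermx X^T != 0 by rewrite kermx_eq0 /row_free mxrank_tr neq_ltn rk.
case/rowV0Pn => y /sub_kermxP yX y0.
have Xy : X *m y^T = 0 by rewrite -[X]trmxK -trmx_mul yX trmx0.
have giX : invmx g *m X *m y^T = 0 by rewrite -mulmxA Xy mulmx0.
have coef (r : 'I_n.+1) : g 0 j * invmx g r 0 * y 0 0 +
    \sum_(l < (h i).+1) (r == widen_ord (ltn_ord (h i)) l)%:R * y 0 (lift 0 l) = 0.
  have /matrixP/(_ r 0) := giX; rewrite [RHS]mxE => e; rewrite -[RHS]e.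
  rewrite [RHS]mxE [RHS]big_ord_recl !mxE; congr (_ * _ + _).
    rewrite (bigD1 0) //= big1 => [|a a0].
      by rewrite addr0 mxE block0 eqxx mulrC.
    by rewrite mxE block0 (negPf a0) mulr0.
  apply: eq_bigr => l _; rewrite !mxE; congr (_ * _).
  have /matrixP/(_ r (widen_ord (ltn_ord (h i)) l)) := mulVmx gu.
  rewrite !mxE => <-; apply: eq_bigr => a _.
  by rewrite [X in _ = _ * X]mxE blockS.
have := coef k; rewrite big1 ?addr0; last first.
  move=> l _; case: eqP => [kl|]; last by rewrite mul0r.
  by move: hk; rewrite kl /= ltnNge -ltnS ltn_ord.
move=> /eqP; rewrite mulf_eq0 => /orP[/eqP //|/eqP y00].
(* If [s v_j] has coefficient 0, the rows up to [h i] kill all the other coefficients, against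
   [y0]. *)
case/eqP: y0; apply/rowP => l; rewrite [RHS]mxE.
case: (unliftP 0 l) => [l'|] -> //.
have := coef (widen_ord (ltn_ord (h i)) l'); rewrite y00 mulr0 add0r.
rewrite (bigD1 l') //= eqxx mul1r big1 ?addr0 // => l2 l2l.
case: eqP => [e|]; last by rewrite mul0r.
by case/eqP: l2l; apply/val_inj; have /(congr1 val) := e.
Qed.

End HessMatrix.

(** * The strata and their charts *)

Section Chart.
Variables (n : nat) (p q : 'I_n.+1).

(** The entries [t k 0] with [0 < k <= q] are not entries of the resulting matrix: they are reused
    as coefficients of the combination of columns that fills column 0 below row 0. *)
Definition chart (T : comNzRingType) (t : 'M[T]_n.+1) : 'M[T]_n.+1 :=
  \matrix_(i, j)
    if i == 0 then if (j < p)%N then 0 else t 0 j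
    else if j == 0 then \sum_(k < n.+1 | (0 < k <= q)%N) t i k * t k 0
    else t i j.

Lemma map_chart (T T' : comNzRingType) (f : {rmorphism T -> T'}) (t : 'M[T]_n.+1) :
  map_mx f (chart t) = chart (map_mx f t).
Proof.
apply/matrixP => i j; rewrite !mxE; case: eqP => [_|_].
  by case: ifP => _; rewrite ?rmorph0.
case: eqP => _ //.
by rewrite rmorph_sum; apply: eq_bigr => k _; rewrite rmorphM !mxE.
Qed.

Definition stratum (T : comNzRingType) (g : 'M[T]_n.+1) (w : 'cV[T]_n.+1) : Prop :=
  [/\ g *m w = delta_mx 0 0, forall j : 'I_n.+1, (j < p)%N -> g 0 j = 0
    & forall k : 'I_n.+1, (q < k)%N -> w k 0 = 0].

(** The rows [i != 0] of [g w = e_0] can be solved for column 0 of [g], with coefficients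
    [- w_k / w_0]. *)
Lemma stratum_chart (K : fieldType) (g : 'M[K]_n.+1) w :
  stratum g w -> w 0 0 != 0 -> exists t, g = chart t.
Proof.
move=> [gw g0 wq] w0.
exists (\matrix_(i, j) if (j == 0) && (i != 0) then - w i 0 / w 0 0 else g i j).
apply/matrixP => i j; rewrite !mxE.
case: (eqVneq i 0) => [->|i0]; first by case: ltnP => [/g0//|_]; rewrite andbF.
case: eqVneq => [->|j0] //.
have /matrixP/(_ i 0) := gw; rewrite !mxE (negPf i0) /= big_ord_recl => /eqP.
rewrite addr_eq0 -subr_eq0 opprK => /eqP gi0.
apply: (mulIf w0); rewrite mulr_suml; apply/eqP; rewrite -subr_eq0 -[X in _ == X]gi0.
apply/eqP; congr (_ + _); rewrite -sumrN.
rewrite [in LHS]big_mkcond big_ord_recl /= add0r; apply: eq_bigr => k _.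
rewrite !mxE /= /bump /= add1n.
case: ltnP => [kq|qk]; first by rewrite mulNr mulrN mulNr opprK -mulrA divfK.
by rewrite wq ?mulr0.
Qed.

(** Every row of the chart but row 0 annihilates [(1, -t_10, ..., -t_q0, 0, ..., 0)]. Invertibility
    makes the product with row 0 nonzero, and rescaling gives [w]. *)
Lemma chart_stratum (K : fieldType) (t : 'M[K]_n.+1) :
  chart t \in unitmx -> exists w, stratum (chart t) w.
Proof.
move=> cu.
pose y : 'cV[K]_n.+1 :=
  \col_k if k == 0 then 1 else if (k <= q)%N then - t k 0 else 0.
pose b := (chart t *m y) 0 0.
have cy : chart t *m y = b *: delta_mx 0 0.
  apply/matrixP => i j; rewrite (ord1 j) [RHS]mxE [X in _ = _ * X]mxE eqxx andbT.
  case: (eqVneq i 0) => [->|i0]; first by rewrite mulr1.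
  rewrite mulr0 mxE big_ord_recl !mxE (negPf i0) /= mulr1 big_mkcond big_ord_recl /=.
  rewrite add0r -big_split big1 //= => k _; rewrite !mxE (negPf i0) /= /bump /= add1n.
  by case: ifP => _; rewrite ?mulr0 ?addr0 // mulrN subrr.
have b0 : b != 0.
  apply/eqP => b0; move: cy; rewrite b0 scale0r => /(congr1 (mulmx (invmx (chart t)))).
  rewrite mulKmx // mulmx0 => /matrixP/(_ 0 0)/eqP.
  by rewrite !mxE /= oner_eq0.
exists (b^-1 *: y); split.
- by rewrite -scalemxAr cy scalerA mulVf // scale1r.
- by move=> j jp; rewrite mxE /= jp.
move=> k qk; rewrite !mxE leqNgt qk /=; case: eqP => [k0|_]; last by rewrite mulr0.
by move: qk; rewrite k0.
Qed.

Lemma chart_unit (K : fieldType) : (p <= q)%N ->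
  exists t : 'M[K]_n.+1, chart t \in unitmx.
Proof.
move=> pq; have [p0|p_gt0] := eqVneq p 0.
  exists 1%:M; have -> : chart 1%:M = 1%:M :> 'M[K]_n.+1; last exact: unitmx1.
  apply/matrixP => i j; rewrite mxE p0 ltn0; case: (eqVneq i 0) => [->//|i0].
  case: (eqVneq j 0) => [->|//]; rewrite [RHS]mxE (negPf i0) big1 // => k /andP[k0 _].
  by rewrite !mxE -!val_eqE /= [k == 0 :> nat]gtn_eqF // mulr0.
have p_gt0' : (0 < p)%N by rewrite lt0n.
have n0p : (0 == p) = false by rewrite eq_sym (negPf p_gt0).
(* The chart of this [t] has row 0 equal to [e_p], row [p] equal to [e_p + e_0], and row [i] equal
   to [e_i] otherwise; [p <= q] lets the coefficient [t p 0 = 1] count. *)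
pose t : 'M[K]_n.+1 := 1%:M + delta_mx p 0 + delta_mx 0 p.
exists t.
have tE i j : t i j = (i == j)%:R + ((i == p) && (j == 0))%:R + ((i == 0) && (j == p))%:R.
  by rewrite !mxE.
have cE i j : chart t i j =
    if i == 0 then (j == p)%:R else (i == j)%:R + ((i == p) && (j == 0))%:R.
  rewrite mxE; case: (eqVneq i 0) => [_|i0].
    rewrite tE n0p /= addr0; case: ltnP => [jp|pj].
      by rewrite -val_eqE /= ltn_eqF.
    case: (eqVneq 0 j) => [j0|_]; last by rewrite add0r.
    by move: pj; rewrite -j0 leqNgt p_gt0'.
  case: (eqVneq j 0) => [->|j0]; last by rewrite tE (negPf i0) (negPf j0) /= addr0.
  rewrite (negPf i0) add0r andbT (bigD1 p) ?p_gt0' ?pq //=.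
  rewrite !tE (negPf i0) (negPf p_gt0) !eqxx /= ?andbF ?addr0 ?add0r mulr1 big1 ?addr0 //.
  move=> k /andP[/andP[k0 _] kp].
  have kn0 : (k == 0) = false by rewrite -val_eqE /= gtn_eqF.
  by rewrite [t k 0]tE kn0 (negPf kp) /= !addr0 mulr0.
rewrite -unitmx_tr -row_free_unit -kermx_eq0; apply/negPn/negP => /rowV0Pn[y].
move=> /sub_kermxP yc; case/negP; apply/eqP/rowP => i; rewrite [RHS]mxE.
have col j : \sum_i y 0 i * chart t j i = 0.
  have /matrixP/(_ 0 j) := yc; rewrite [RHS]mxE => e; rewrite -[RHS]e mxE.
  by apply: eq_bigr => k _; rewrite [(_^T)%R _ _]mxE.
have yp : y 0 p = 0.
  have := col 0; rewrite (bigD1 p) //= cE !eqxx mulr1 big1 ?addr0 // => k kp.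
  by rewrite cE eqxx (negPf kp) mulr0.
have yi k : k != 0 -> y 0 k + (k == p)%:R * y 0 0 = 0.
  move=> k0; have := col k; rewrite (bigD1 k) //= cE (negPf k0) eqxx andbF addr0 mulr1.
  rewrite (bigD1 0) /=; last by rewrite eq_sym.
  rewrite cE (negPf k0) eqxx andbT add0r [y 0 0 * _]mulrC big1 ?addr0 //.
  move=> l /andP[lk l0]; rewrite cE (negPf k0) (negPf l0) andbF addr0.
  by rewrite eq_sym (negPf lk) mulr0.
have [->|i0] := eqVneq i 0; first by have := yi p p_gt0; rewrite yp eqxx mul1r add0r.
have [->//|ip] := eqVneq i p.
by have := yi i i0; rewrite (negPf ip) mul0r addr0.
Qed.

End Chart.

(** * The chart as a ring morphism *)

HB.lock Definition chart_mor (n : nat) (p q : 'I_n.+1) (C : fieldType) :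
    {rmorphism mpoly (n.+1 * n.+1) C -> mpoly (n.+1 * n.+1) C} :=
  mxev (@mpolyC (n.+1 * n.+1) C) (chart p q (varmx C n.+1)).

Section ChartMor.
Variables (n : nat) (p q : 'I_n.+1) (C : fieldType).
Local Notation Cz := (mpoly (n.+1 * n.+1) C).
Local Notation phi := (chart_mor p q C).

Lemma chart_morE f : phi f = mxev (@mpolyC (n.+1 * n.+1) C) (chart p q (varmx C n.+1)) f.
Proof. by rewrite chart_mor.unlock. Qed.

Lemma mxev_chart (T : comNzRingType) (iota : {rmorphism C -> T}) (t : 'M[T]_n.+1) f :
  mxev iota t (phi f) = mxev iota (chart p q t) f.
Proof.
rewrite chart_morE (mxev_comp (iota' := iota)) => [|c]; last by rewrite mxevC.
by rewrite map_chart mxev_generic.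
Qed.

(* On the locus [w_0 = 0] the chart does not apply; we move along a line of the
   stratum that leaves this locus. *)
Lemma stratum_mxev_eq0 (K : fieldType) (iota : {rmorphism C -> K})
    (g : 'M[K]_n.+1) w f : [pchar C] =i pred0 ->
  stratum p q g w -> phi f = 0 -> mxev iota g f = 0.
Proof.
move=> /pcharf0P natr0.
have in_chart g' w' : stratum p q g' w' -> w' 0 0 != 0 -> phi f = 0 ->
    mxev iota g' f = 0.
  by move=> sg w0 cf; have [t ->] := stratum_chart sg w0; rewrite -mxev_chart cf rmorph0.
move=> sg cf; have [w0|w0] := eqVneq (w 0 0) 0; last exact: in_chart sg w0 cf.
have [gw gp wq] := sg.
have [r wr] : exists r, w r 0 != 0.
  apply/existsP; rewrite -negb_forall; apply/negP => /forallP w_eq0.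
  have : g *m w = 0.
    rewrite (_ : w = 0) ?mulmx0 //; apply/matrixP => i j; rewrite (ord1 j) [RHS]mxE.
    exact/eqP.
  by rewrite gw => /matrixP/(_ 0 0)/eqP; rewrite !mxE /= oner_eq0.
have r0 : r != 0 by apply: contraNneq wr => ->; rewrite w0.
have r0' : (0 : 'I_n.+1) != r by rewrite eq_sym.
(* Right multiplication by [E x] subtracts [x] times column 0 from column [r]. The stratum is
   preserved, with [w] replaced by [(1 + x e_0r) w], whose entry 0 is [x w_r]. *)
pose E (T : comNzRingType) (x : T) : 'M[T]_n.+1 := 1%:M - x *: delta_mx 0 r.
pose P := mxev (polyC \o iota : {rmorphism C -> {poly K}})
  (map_mx polyC g *m E _ 'X) f.
have Px x : P.[x] = mxev iota (g *m E _ x) f.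
  rewrite -horner_evalE (mxev_comp (iota' := iota)) => [|c]; last first.
    by rewrite /= /horner_eval hornerC.
  congr (mxev _ _ _); rewrite map_mxM; congr (_ *m _).
    by apply/matrixP => i j; rewrite !mxE /= horner_evalE hornerC.
  apply/matrixP => i j; rewrite !mxE /= horner_evalE.
  by rewrite !(raddfMn, hornerMn, hornerE) /=.
suff P0 : P = 0 by have := Px 0; rewrite P0 horner0 /E scale0r subr0 mulmx1.
(* In characteristic 0 the values [k + 1] are distinct and nonzero, so [P] gets more roots than its
   degree allows. *)
have Pn k : root P k.+1%:R.
  rewrite /root Px; set x := k.+1%:R.
  have x0 : x != 0 by rewrite /x -(rmorph_nat iota) fmorph_eq0 natr0.
  apply/eqP; apply: (in_chart _ ((1%:M + x *: delta_mx 0 r) *m w)) => //.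
    split.
    - rewrite -gw -mulmxA; congr (_ *m _); rewrite mulmxA /E.
      rewrite mulmxBl mul1mx -scalemxAl mulmxDr mulmx1 -scalemxAr.
      by rewrite mul_delta_mx_0 // !scaler0 addr0 addrK mul1mx.
    - move=> j jp; rewrite mulmxBr mulmx1 mxE gp // -scalemxAr !mxE.
      rewrite big1 ?mulr0 ?subr0 // => i _; rewrite mxE.
      case: (eqVneq i 0) => [->|i0]; last by rewrite mulr0.
      by rewrite gp ?mul0r // (leq_ltn_trans _ jp).
    - move=> j qj; rewrite mulmxDl mul1mx mxE wq // add0r -scalemxAl mxE mxE.
      rewrite big1 ?mulr0 // => i _; rewrite mxE (_ : j == 0 = false) ?mul0r //.
      by apply/negP => /eqP j0; rewrite j0 in qj.
  rewrite mulmxDl mul1mx mxE w0 add0r -scalemxAl mxE mxE (bigD1 r) //= mxE !eqxx mul1r.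
  rewrite big1 ?addr0 ?mulf_neq0 // => i ir.
  by rewrite mxE (negPf ir) andbF mul0r.
apply: (roots_geq_poly_eq0 (rs := [seq k.+1%:R | k <- seq.iota 0 (size P)])).
- by apply/allP => _ /mapP[k _ ->].
- rewrite map_inj_uniq ?iota_uniq // => k l.
  rewrite -!(rmorph_nat iota) => /fmorph_inj /eqP kl.
  wlog lek : k l kl / (k <= l)%N.
    by move=> H; case: (leqP k l) => [/H->//|/ltnW/H->//]; rewrite eq_sym.
  move: kl; rewrite eq_sym -subr_eq0 -natrB ?ltnS // natr0 subSS subn_eq0 => lk.
  by apply/eqP; rewrite eqn_leq lek.
by rewrite size_map size_iota.
Qed.

End ChartMor.

(** * Growth forced by chains of primes *)

Section Growth.
Variables (F : fieldType) (A : comAlgType F) (deg : A -> nat).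
Hypothesis deg1 : deg 1 = 0%N.
Hypothesis degM : forall x y, (deg (x * y) <= deg x + deg y)%N.

Lemma deg_exp x j : (deg (x ^+ j) <= j * deg x)%N.
Proof.
elim: j => [|j IH]; first by rewrite expr0 deg1.
by rewrite exprS mulSn (leq_trans (degM _ _)) // leq_add2l.
Qed.

Definition independent_mod (P : Spec A) (I : finType) (b : I -> A) : Prop :=
  forall c : I -> F, P (\sum_i c i *: b i) -> forall i, c i = 0.

(** Modulo [Q] only the term [j = 0] remains, so its coefficients vanish. The rest is a multiple of
    [x], which cancels because [P] is prime and does not contain [x]. *)
Lemma independent_mod_powers (P Q : Spec A) x (I : finType) (b : I -> A) :
  prime_le P Q -> Q x -> ~~ P x -> independent_mod Q b ->
  forall m (c : nat -> I -> F), P (\sum_(j < m) x ^+ j * \sum_i c j i *: b i) ->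
  forall j i, (j < m)%N -> c j i = 0.
Proof.
move=> PQ Qx nPx bQ; elim=> [//|m IH] c.
rewrite big_ord_recl expr0 mul1r => Pc.
have Psplit : \sum_(j < m) x ^+ (lift ord0 j) * (\sum_i c (lift ord0 j) i *: b i) =
    x * \sum_(j < m) x ^+ j * (\sum_i c j.+1 i *: b i).
  by rewrite mulr_sumr; apply: eq_bigr => j _; rewrite mulrA -exprS lift0.
rewrite Psplit in Pc.
have c0 i : c 0%N i = 0.
  apply: (bQ (c 0%N)) => //; set B := \sum_i _ in Pc *.
  have -> : B = (B + x * \sum_(j < m) x ^+ j * (\sum_i c j.+1 i *: b i)) +
      - (\sum_(j < m) x ^+ j * (\sum_i c j.+1 i *: b i)) * x.
    by rewrite mulNr [_ * x]mulrC addrK.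
  by apply: SpecD; [exact: PQ|exact: SpecMl].
move=> [|j] i; first by rewrite c0.
rewrite ltnS; apply: (IH (fun j => c j.+1)).
move: Pc; rewrite big1 ?add0r => [|i' _]; last by rewrite c0 scale0r.
by rewrite Spec_mul (negPf nPx).
Qed.

(* A chain of length [k] of primes forces polynomial growth of degree [k]:
   the powers of an element of [Q 1] outside [Q 0] are independent modulo
   [Q 0] over any family that is independent modulo [Q 1]. *)
Lemma prime_chain_growth k (Q : nat -> Spec A) : prime_chain k Q ->
  exists D : nat, forall m : nat, exists (I : finType) (b : I -> A),
    [/\ #|I| = (m ^ k)%N, forall i, (deg (b i) <= D * m)%N
      & independent_mod (Q 0%N) b].
Proof.
elim: k Q => [|k IH] Q ch.
  exists 0%N => m; exists unit, (fun=> 1); split; rewrite ?card_unit ?deg1 //= => c.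
  rewrite (bigD1 tt) //= big1 ?addr0 => [Qc []|[] //].
  apply/eqP/negPn/negP => c0; have := SpecMl (c tt)^-1%:A Qc.
  by rewrite mulr_algl scalerA mulVf // scale1r Spec1.
have [|D bD] := IH (fun i => Q i.+1); first by move=> i ik; apply: ch.
have [Q01 [x Q1x nQ0x]] := ch 0%N isT.
exists (D + deg x)%N => m; have [I [b [cI db bQ]]] := bD m.
exists ('I_m * I)%type, (fun u : 'I_m * I => x ^+ u.1 * b u.2); split.
- by rewrite card_prod card_ord cI expnS.
- move=> [j i] /=; apply: leq_trans (degM _ _) _.
  rewrite mulnDl addnC leq_add // (leq_trans (deg_exp _ _)) // mulnC leq_mul2l.
  by rewrite (ltnW (ltn_ord j)) orbT.
move=> c Qc [j i].
have [m' mE] : exists m', m = m'.+1 by case: (m) j => [[]//|m' _]; exists m'.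
(* Coefficients are extended by 0 to all natural exponents, the form that [independent_mod_powers]
   takes. *)
pose c' j i := if insub j is Some j' then c (j', i) else 0.
have c'E (j' : 'I_m) i' : c' j' i' = c (j', i') by rewrite /c' valK.
rewrite -c'E; apply: (independent_mod_powers Q01 Q1x nQ0x bQ) (ltn_ord j).
rewrite (eq_bigr (fun j : 'I_m => \sum_i c (j, i) *: (x ^+ j * b i))).
  by rewrite pair_bigA; apply: etrans Qc; congr (Q 0%N _); apply: eq_bigr => -[].
move=> j' _; rewrite mulr_sumr; apply: eq_bigr => i' _.
by rewrite c'E scalerAr.
Qed.

End Growth.

(** * Counting independent polynomials in a subset of the variables *)

HB.lock Definition restrict_vars (F : fieldType) (M : nat) (S : {pred 'I_M}) :
    {rmorphism mpoly M F -> mpoly M F} :=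
  mmap (@mpolyC M F) (fun k => if k \in S then mpolyX F (mnm1 k) else 0).

Section Counting.
Variables (F : fieldType) (M : nat) (S : {pred 'I_M}).
Local Notation Fz := (mpoly M F).
Local Notation rho := (restrict_vars F S).

Lemma restrict_varsC c : rho (mpolyC M c) = mpolyC M c.
Proof. by rewrite restrict_vars.unlock; exact: mmapC. Qed.

Lemma restrict_varsXU k :
  rho (mpolyX F (mnm1 k)) = if k \in S then mpolyX F (mnm1 k) else 0.
Proof. by rewrite restrict_vars.unlock /= mmapX mmap1U. Qed.

Lemma restrict_varsX (m : multinom M) k : m k != 0%N -> k \notin S ->
  rho (mpolyX F m) = 0.
Proof.
move=> mk kS; rewrite restrict_vars.unlock /= mmapX /mmap1 (bigD1 k) //= (negPf kS).
by rewrite expr0n (negPf mk) mul0r.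
Qed.

(** Being fixed by [rho] means involving only the variables in [S]. Such polynomials of degree at
    most [d] are determined by their coefficients at the [d.+1 ^ #|S|] monomials with exponents at
    most [d], so a larger family would be dependent. *)
Lemma card_independent_le d (I : finType) (b : I -> Fz) :
  (forall i, msize (b i) <= d.+1)%N ->
  (forall i, rho (b i) = b i) ->
  (forall c : I -> F, \sum_i c i *: b i = 0 -> forall i, c i = 0) ->
  (#|I| <= d.+1 ^ #|S|)%N.
Proof.
move=> bd bS ind.
pose Mon := {ffun {k | k \in S} -> 'I_d.+1}.
pose mon (u : Mon) : multinom M :=
  Multinom [tuple (if insub k is Some s then u s : nat else 0%N) | k < M].
have cMon : #|{: Mon}| = (d.+1 ^ #|S|)%N by rewrite card_ffun card_ord card_sig.
rewrite -cMon leqNgt; apply/negP => lt.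
pose B : 'M[F]_(#|I|, #|{: Mon}|) :=
  \matrix_(i, u) mcoeff (mon (enum_val u)) (b (enum_val i)).
have : kermx B != 0.
  by rewrite kermx_eq0 /row_free neq_ltn (leq_ltn_trans (rank_leq_col B)).
case/rowV0Pn => y /sub_kermxP yB; case/eqP; apply/rowP => i; rewrite [RHS]mxE.
pose c j := y 0 (enum_rank j).
suff c0 : \sum_j c j *: b j = 0.
  by have := ind c c0 (enum_val i); rewrite /c enum_valK.
set G := \sum_j _.
have Gmon u : mcoeff (mon u) G = 0.
  have /matrixP/(_ 0 (enum_rank u)) := yB; rewrite [RHS]mxE => e; rewrite -[RHS]e.
  rewrite mxE raddf_sum (reindex (@enum_val I predT)) /=.
    by apply: eq_bigr => j _; rewrite /c enum_valK mxE enum_rankK mcoeffZ.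
  by exists enum_rank => j _; rewrite ?enum_valK ?enum_rankK.
have GS : rho G = G.
  rewrite rmorph_sum; apply: eq_bigr => j _.
  by rewrite -mul_mpolyC rmorphM bS restrict_varsC.
have Gd : (msize G <= d.+1)%N.
  apply: leq_trans (mmeasure_sum _ _ _ _) _; apply/bigmax_leqP => j _.
  exact: leq_trans (mmeasureZ_le _ _ _) (bd j).
rewrite -GS (mpolyE G) rmorph_sum big_seq big1 // => m mG.
rewrite -mul_mpolyC rmorphM.
have [mS|] := boolP [forall k, (m k != 0%N) ==> (k \in S)].
  pose u : Mon := [ffun s => inord (m (val s))].
  have -> : m = mon u.
    apply/mnmP => k; rewrite multinomE tnth_mktuple.
    case: insubP => [s _ <-|kS].
      rewrite ffunE inordK // (leq_trans _ Gd) //; apply: leq_ltn_trans (msize_mdeg_lt mG).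
      by rewrite mdegE (bigD1 (val s)) //= leq_addr.
    by have := forallP mS k; rewrite (negPf kS) implybF negbK => /eqP.
  by rewrite Gmon mpolyC0 rmorph0 mul0r.
rewrite negb_forall => /existsP[k]; rewrite negb_imply => /andP[mk kS].
by rewrite (restrict_varsX mk kS) mulr0.
Qed.

End Counting.

(** If [N < k], then [m = (D + 1)^N + 1] violates the bound, which would give
    [m^(N+1) <= (D + 1)^N m^N]. *)
Lemma leq_of_poly_growth (D k N : nat) :
  (forall m, m ^ k <= (D * m).+1 ^ N)%N -> (k <= N)%N.
Proof.
move=> gr; rewrite leqNgt; apply/negP => Nk.
pose m := (D.+1 ^ N).+1.
have : (m ^ N.+1 <= (D.+1 * m) ^ N)%N.
  apply: leq_trans (leq_trans (gr m) _); first by rewrite leq_pexp2l.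
  case: (N) => [//|N']; rewrite leq_exp2r // mulSn -[(D * m).+1]add1n.
  by rewrite leq_add2r.
by rewrite expnMn expnS leq_pmul2r ?expn_gt0 // ltnn.
Qed.

(** * The number of coordinates of a chart bounds the dimension from above *)

Section ChartVars.
Variables (n : nat) (p q : 'I_n.+1).

(* The entries on which [chart p q] depends. *)
Definition chart_var (i j : 'I_n.+1) : bool :=
  if i == 0 then (p <= j)%N else if j == 0 then (i <= q)%N else true.

Definition chart_vars : {pred 'I_(n.+1 * n.+1)} :=
  fun k => mxvec (\matrix_(i, j) chart_var i j) 0 k.

Lemma mem_chart_vars i j : (mxvec_index i j \in chart_vars) = chart_var i j.
Proof. by rewrite unfold_in /chart_vars mxvecE mxE. Qed.

(** The entries left out are the first [p] of row 0 and the last [n - q] of column 0. *)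
Lemma card_chart_vars : (#|chart_vars| + p + (n - q) = n.+1 * n.+1)%N.
Proof.
have sumlt m (k : nat) : (k <= m)%N -> (\sum_(j < m) (j < k)%N = k)%N.
  by move=> km; rewrite -big_mkcond /= (big_ord_narrow km) sum_nat_const card_ord muln1.
rewrite -[RHS]card_ord -(cardC chart_vars) -addnA; congr (_ + _)%N.
rewrite -sum1_card big_mkcond (reindex _ (curry_mxvec_bij _ _)) /=.
rewrite (eq_bigr (fun u => (~~ chart_var u.1 u.2 : nat))) => [|[i j] _]; last first.
  by rewrite !inE /= mem_chart_vars; case: chart_var.
rewrite -(pair_bigA _ (fun i j => (~~ chart_var i j : nat))) /= big_ord_recl.
congr (_ + _)%N.
  rewrite -[LHS](sumlt n.+1) 1?ltnW //; apply: eq_bigr => j _.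
  by rewrite /chart_var eqxx -ltnNge.
have := sumlt n q; rewrite -ltnS ltn_ord => /(_ isT) sq.
have -> : (n - q = \sum_(i < n) (q <= i)%N)%N.
  apply/eqP; rewrite -(eqn_add2l q) -[X in (X + \sum_(i < n) _)%N]sq -big_split /=.
  rewrite subnKC -1?ltnS // (eq_bigr (fun=> 1%N)) => [|i _].
    by rewrite sum_nat_const card_ord muln1.
  by case: ltnP.
apply: eq_bigr => i _; rewrite /chart_var big_ord_recl /= -ltnNge ltnS.
by rewrite big1 ?addn0.
Qed.

Variable C : fieldType.
Local Notation Cz := (mpoly (n.+1 * n.+1) C).
Local Notation Z := (varmx C n.+1).
Local Notation phi := (chart_mor p q C).

Lemma chart_mor_restrict f : restrict_vars C chart_vars (phi f) = phi f.
Proof.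
pose m : 'M[Cz]_n.+1 := \matrix_(i, j) if chart_var i j then Z i j else 0.
have -> : restrict_vars C chart_vars (phi f) = mxev (@mpolyC (n.+1 * n.+1) C) m (phi f).
  apply: rmorph_mxev => [c|]; first by rewrite restrict_varsC.
  apply/matrixP => i j; rewrite !mxE restrict_varsXU mem_chart_vars.
  by case: ifP.
rewrite (mxev_chart p q (@mpolyC (n.+1 * n.+1) C) m f) chart_morE.
suff -> : chart p q m = chart p q Z by [].
apply/matrixP => i j; rewrite !mxE.
case: (eqVneq i 0) => [_|i0].
  by case: ltnP => // pj; rewrite /chart_var eqxx pj.
case: (eqVneq j 0) => [j0|j0]; last by rewrite /chart_var (negPf i0) (negPf j0).
apply: eq_bigr => k /andP[k0 kq]; rewrite !mxE /chart_var (negPf i0) eqxx kq.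
have -> : (k == 0) = false by rewrite -val_eqE /= gtn_eqF.
by [].
Qed.

(** Degrees are measured after applying [phi]. A family independent modulo [Q 0] is independent
    modulo the kernel of [phi], so it maps to independent polynomials in the chart coordinates;
    counting these against the growth [m ^ k] bounds [k]. *)
Lemma prime_chain_chart_le (P : Spec Cz) k (Q : nat -> Spec Cz) :
  (forall f, P f = (phi f == 0)) -> prime_chain k Q -> prime_le P (Q 0%N) ->
  (k <= #|chart_vars|)%N.
Proof.
move=> Pphi ch PQ.
have [||D grow] := prime_chain_growth (F := C) (deg := fun f => (msize (phi f)).-1) _ _ ch.
- by rewrite rmorph1 msize1.
- move=> x y; rewrite rmorphM; have [->|x0] := eqVneq (phi x) 0.
    by rewrite mul0r msize0.
  have [->|y0] := eqVneq (phi y) 0; first by rewrite mulr0 msize0.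
  rewrite msizeM //; move: x0 y0; rewrite -!msize_poly_eq0.
  by case: (msize _) => // a _; case: (msize _) => // b _; rewrite addnS.
apply: (@leq_of_poly_growth D) => m; have [I [b [<- db ind]]] := grow m.
apply: (card_independent_le (b := fun i => phi (b i))) => [i|i|c cb i].
- by apply: leq_trans (leqSpred _) _; rewrite ltnS.
- exact: chart_mor_restrict.
apply: ind; apply: PQ; rewrite Pphi rmorph_sum -[X in _ == X]cb; apply/eqP.
by apply: eq_bigr => j _; rewrite -!mul_mpolyC rmorphM [X in X * _ = _]chart_morE mxevC.
Qed.

End ChartVars.

(** * A chain of primes whose length is the number of coordinates *)

Section ChartChain.
Variables (n : nat) (C : fieldType).
Local Notation Cz := (mpoly (n.+1 * n.+1) C).
Local Notation Z := (varmx C n.+1).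
Local Notation ev := (mxev (@mpolyC (n.+1 * n.+1) C)).

Definition minor_mx : 'M[Cz]_n := row' 0 (col' 0 Z).
Definition minor_det : Cz := \det minor_mx.
(** Cramer numerators, over [minor_det], of the coefficients expressing column 0 through the other
    columns below row 0. *)
Definition solution_num : 'cV[Cz]_n := \adj minor_mx *m \col_a Z (lift 0 a) 0.

Lemma mxev_var (T : comNzRingType) (iota : {rmorphism C -> T}) (g : 'M[T]_n.+1) i j :
  mxev iota g (Z i j) = g i j.
Proof. by have /matrixP/(_ i j) := mxev_generic iota g; rewrite [LHS]mxE. Qed.

Lemma mxev_minor_det (T : comNzRingType) (iota : {rmorphism C -> T}) :
  mxev iota 1%:M minor_det = 1.
Proof.
rewrite -det_map_mx -[RHS](det1 T n); congr (\det _).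
apply/matrixP => i j; rewrite mxE [minor_mx _ _]mxE [col' _ _ _ _]mxE mxev_var !mxE.
by rewrite (inj_eq lift_inj).
Qed.

Lemma minor_det_neq0 : minor_det != 0.
Proof.
apply/eqP => d0; have := mxev_minor_det (@idfun C : {rmorphism C -> C}).
by rewrite d0 rmorph0 => /eqP; rewrite eq_sym oner_eq0.
Qed.

Section Index.
Variables (p q : 'I_n.+1).
Local Notation phi := (chart_mor p q C).

Lemma chart_mor_var i j : phi (Z i j) = chart p q Z i j.
Proof. by rewrite chart_morE; exact: mxev_var. Qed.

Lemma chart_mor_minor : map_mx phi minor_mx = minor_mx.
Proof.
apply/matrixP => i j; rewrite mxE [minor_mx _ _]mxE [col' _ _ _ _]mxE.
by rewrite chart_mor_var mxE.
Qed.

Lemma chart_mor_minor_det : phi minor_det = minor_det.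
Proof. by rewrite -det_map_mx chart_mor_minor. Qed.

(** In the chart, column 0 below row 0 is [minor_mx] times the coefficient vector, and the adjugate
    recovers that vector times [minor_det]. Position [a] belongs to column [a + 1], whence
    [a < q]. *)
Lemma chart_mor_num a : phi (solution_num a 0) =
  if (a < q)%N then minor_det * Z (lift 0 a) 0 else 0.
Proof.
pose u : 'cV[Cz]_n := \col_a if (a < q)%N then Z (lift 0 a) 0 else 0.
have phiE : map_mx phi solution_num = minor_det *: u.
  rewrite -mul_scalar_mx -mul_adj_mx -mulmxA map_mxM map_mx_adj chart_mor_minor.
  congr (_ *m _); apply/matrixP => i j.
  rewrite [LHS]mxE [X in phi X]mxE chart_mor_var.
  rewrite !mxE /= big_mkcond big_ord_recl /= add0r; apply: eq_bigr => b _.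
  by rewrite !mxE /=; case: ltnP => _ //; rewrite mulr0.
have /matrixP/(_ a 0) := phiE; rewrite !mxE => ->.
by case: ltnP => _ //; rewrite mulr0.
Qed.

(** This inverts the chart up to the factor [minor_det]; it serves to separate consecutive primes of
    the chain. *)
Lemma chart_mor_preimage i j : chart_var p q i j ->
  exists a, phi a = minor_det * Z i j.
Proof.
rewrite /chart_var; have [->|i0] := eqVneq i 0 => [pj|].
  exists (minor_det * Z 0 j); rewrite rmorphM chart_mor_minor_det chart_mor_var mxE.
  by rewrite eqxx ltnNge pj.
have [->|j0] := eqVneq j 0 => [iq|_]; last first.
  exists (minor_det * Z i j); rewrite rmorphM chart_mor_minor_det chart_mor_var mxE.
  by rewrite (negPf i0) (negPf j0).
case: (unliftP 0 i) => [a ia|/eqP]; last by rewrite (negPf i0).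
have aq : (a < q)%N by move: iq; rewrite ia.
by exists (solution_num a 0); rewrite chart_mor_num aq ia.
Qed.

(** Entries that are not coordinates get the index [#|chart_vars p q|], so [specialize l] leaves
    them alone for all [l] up to that number. *)
Definition chart_index (i j : 'I_n.+1) : nat :=
  index (mxvec_index i j) (enum (chart_vars p q)).

Definition specialize (l : nat) : 'M[Cz]_n.+1 :=
  \matrix_(i, j) if (chart_index i j < l)%N then (i == j)%:R else Z i j.

Lemma specialize_le l l' f : (l <= l')%N ->
  ev (specialize l') (ev (specialize l) f) = ev (specialize l') f.
Proof.
move=> ll'; rewrite (mxev_comp (iota' := @mpolyC (n.+1 * n.+1) C)) => [|c].
  suff -> : map_mx (ev (specialize l')) (specialize l) = specialize l' by [].
  apply/matrixP => i j; rewrite mxE [specialize l _ _]mxE; case: ltnP => lij.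
    by rewrite rmorph_nat mxE (leq_trans lij ll').
  exact: mxev_var.
by rewrite mxevC.
Qed.

Lemma specialize_minor_det l : ev (specialize l) minor_det != 0.
Proof.
apply/eqP => d0; pose id := @idfun C : {rmorphism C -> C}.
have : mxev id 1%:M (ev (specialize l) minor_det) = 0 by rewrite d0 rmorph0.
rewrite (mxev_comp (iota' := id)) => [|c]; last by rewrite mxevC.
suff -> : map_mx (mxev id 1%:M) (specialize l) = 1%:M.
  by rewrite mxev_minor_det => /eqP; rewrite oner_eq0.
apply/matrixP => i j; rewrite mxE [specialize l _ _]mxE; case: ltnP => _.
  by rewrite rmorph_nat mxE.
exact: mxev_var.
Qed.

(** [Q l] is the kernel of [phi] followed by setting the first [l] coordinates to the entries of the
    identity matrix. *)
Lemma prime_chain_chart : exists2 Q : nat -> Spec Cz,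
  prime_chain #|chart_vars p q| Q & forall f, phi f = 0 -> Q 0%N f.
Proof.
have dom : prime_idealr_closed (fun b : Cz => b == 0).
  by move=> u v; rewrite /in_mem /= mulf_eq0.
have /choice[Q QE] : forall l, exists Q : Spec Cz,
    forall f, Q f = (ev (specialize l) (phi f) == 0).
  by move=> l; apply: (kernel_spec (ev (specialize l) \o phi)%FUN dom).
exists Q => [l lS|f f0]; last by rewrite QE f0 rmorph0.
split=> [f|].
  rewrite !QE => /eqP f0.
  by rewrite -(specialize_le (phi f) (leqnSn l)) f0 rmorph0.
have [x0 _] : exists x : 'I_(n.+1 * n.+1), true by exists ord0.
have lE : (l < size (enum (chart_vars p q)))%N by rewrite -cardE.
have : nth x0 (enum (chart_vars p q)) l \in chart_vars p q.
  by rewrite -mem_enum mem_nth.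
have : index (nth x0 (enum (chart_vars p q)) l) (enum (chart_vars p q)) = l.
  by rewrite index_uniq ?enum_uniq.
case/mxvec_indexP: (nth _ _ _) => i j; rewrite -/(chart_index i j) => ijl.
rewrite mem_chart_vars => /chart_mor_preimage[a phia].
(* Its image under [phi] is [minor_det * (Z i j - (i == j))]. The second factor dies at stage
   [l + 1], and neither factor is 0 at stage [l]. *)
exists (a - minor_det * (i == j)%:R).
  rewrite QE rmorphB phia rmorphM chart_mor_minor_det rmorph_nat -mulrBr rmorphM.
  rewrite rmorphB mxev_var mxE ijl ltnSn rmorph_nat subrr mulr0 //.
rewrite QE rmorphB phia rmorphM chart_mor_minor_det rmorph_nat -mulrBr rmorphM.
rewrite mulf_neq0 ?specialize_minor_det // rmorphB mxev_var mxE ijl ltnn rmorph_nat.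
apply/eqP => zij; pose id := @idfun C : {rmorphism C -> C}.
(* The matrix is [1 + delta_mx i j], at which [Z i j - (i == j)] takes the value 1. *)
have : mxev id (1%:M + 1%:M + delta_mx i j - 1%:M) (Z i j - (i == j)%:R) = 0.
  by rewrite zij rmorph0.
rewrite rmorphB mxev_var rmorph_nat addrAC addrK !mxE !eqxx addrAC subrr add0r.
by move=> /eqP; rewrite oner_eq0.
Qed.

End Index.
End ChartChain.

(** * The minimal primes over the saturated ideal, indexed by the corners *)

Section HessenbergPrimes.
Variables (n : nat) (h : hessenberg n.+1) (C : fieldType).
Hypothesis char0 : [pchar C] =i pred0.
Local Notation Cz := (mpoly (n.+1 * n.+1) C).
Local Notation Z := (varmx C n.+1).
Local Notation phi p := (chart_mor p (h p) C).

Definition minors_vanish (K : fieldType) (g : 'M[K]_n.+1) : Prop :=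
  forall (i : 'I_n.+1) (f : 'I_(h i).+2 -> 'I_n.+1)
         (c : 'I_(h i).+2 -> 'I_(i.+1 + (h i).+1)),
    ((h i).+1 < n.+1)%N -> {homo f : a b / (a < b)%N} -> {homo c : a b / (a < b)%N} ->
    \det (mxsub f c (hess_block h g i)) = 0.

Variable I : set Cz.
Hypothesis I0 : I 0.
Hypothesis ID : forall u v, I u -> I v -> I (u + v).
Hypothesis IM : forall a u, I u -> I (a * u).
(** The generators of [I] enter only through its zeros over fields. *)
Hypothesis Iminors : forall (K : fieldType) (F : {rmorphism Cz -> K}),
  (forall x, I x -> F x = 0) <-> minors_vanish (map_mx F Z).

Definition det_saturation : set Cz := [set x | exists k, I (\det Z ^+ k * x)].

Lemma hess_mono (i j : 'I_n.+1) : (i <= j)%N -> (h i <= h j)%N.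
Proof.
move=> /subnKC; move: (j - i)%N => d; elim: d i => [|d IH] i ij.
  by rewrite addn0 in ij; rewrite (val_inj ij).
have i1 : (i.+1 < n.+1)%N.
  by rewrite (leq_ltn_trans _ (ltn_ord j)) // -ij addnS ltnS leq_addr.
apply: leq_trans (hess_homo h (j := Ordinal i1) erefl) _.
by apply: IH; rewrite addSnnS.
Qed.

Lemma corner_ltn (i j : 'I_n.+1) : corner h j -> (i < j)%N -> (h i < h j)%N.
Proof.
move=> cj ij; have j1 : (j.-1 < n.+1)%N by rewrite (leq_ltn_trans (leq_pred _)).
have jE : j.-1.+1 = j by rewrite prednK // (leq_ltn_trans _ ij).
by apply: leq_ltn_trans (cj (Ordinal j1) jE); apply: hess_mono; rewrite /= -ltnS jE.
Qed.

Lemma stratum_minors_vanish (K : fieldType) (g : 'M[K]_n.+1) p w :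
  stratum p (h p) g w -> minors_vanish g.
Proof.
move=> [gw g0 wq] i f c _ _ _; apply: hess_block_minors_eq0 gw _ => j k ji hk.
have [jp|pj] := ltnP j p; first by rewrite g0 ?mul0r.
by rewrite wq ?mulr0 // (leq_ltn_trans _ hk) // hess_mono // (leq_trans pj).
Qed.

Lemma det_chart_neq0 p : phi p (\det Z) != 0.
Proof.
have [t tu] := chart_unit C (hess_ge h p).
apply: contraTneq tu => d0; rewrite unitmxE unitfE negbK.
pose id := @idfun C : {rmorphism C -> C}.
by rewrite -(mxev_det id) -mxev_chart d0 rmorph0.
Qed.

(** Over the fraction field the chart is an invertible matrix on the stratum, hence a zero of [I],
    and the power of the determinant cancels. *)
Lemma det_saturation_chart p x : det_saturation x -> phi p x = 0.
Proof.
move=> [k Ix].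
pose F : {rmorphism Cz -> {fraction Cz}} := (@tofrac Cz \o phi p)%FUN.
have FZ : map_mx F Z = chart p (h p) (map_mx (@tofrac Cz) Z).
  rewrite -map_chart; apply/matrixP => i j.
  by rewrite mxE [RHS]mxE /= chart_mor_var.
have Fu : map_mx F Z \in unitmx.
  by rewrite unitmxE unitfE det_map_mx /= tofrac_eq0 det_chart_neq0.
have /Iminors FI : minors_vanish (map_mx F Z).
  rewrite FZ in Fu *; have [w] := chart_stratum Fu.
  exact: stratum_minors_vanish.
have := FI _ Ix; rewrite rmorphM rmorphXn => /eqP; rewrite mulf_eq0 expf_eq0.
by rewrite /= !tofrac_eq0 (negPf (det_chart_neq0 p)) andbF => /eqP.
Qed.

Lemma stratum_of_point (K : fieldType) (g : 'M[K]_n.+1) :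
  g \in unitmx -> minors_vanish g ->
  exists2 p, corner h p & exists w, stratum p (h p) g w.
Proof.
move=> gu minors.
have [j0 gj0] : exists j0, g 0 j0 != 0.
  apply/existsP; rewrite -negb_forall; apply/negP => /forallP g0.
  have /matrixP/(_ 0 0)/eqP := mulmxV gu; rewrite !mxE big1 ?eqxx /=.
    by rewrite eq_sym oner_eq0.
  by move=> j _; rewrite (eqP (g0 j)) mul0r.
case: (arg_minnP (P := fun j => g 0 j != 0) (fun j : 'I_n.+1 => j : nat) gj0).
move=> p0 gp0 p0min.
(* The least index with the same value of [h] as [p0] is a corner, and it is at most [p0], so row 0
   still vanishes before it. *)
case: (arg_minnP (P := fun j => h j == h p0) (fun j : 'I_n.+1 => j : nat) (eqxx _)).
move=> p /eqP hp pmin; exists p.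
  move=> j jp; rewrite ltn_neqAle (hess_homo h jp) andbT; apply/eqP => hj.
  have : (p <= j)%N by apply: pmin; rewrite -val_eqE /= hj hp.
  by rewrite -jp ltnn.
exists (col 0 (invmx g)); split.
- apply/matrixP => i j.
  have /matrixP/(_ i 0) := mulmxV gu; rewrite !mxE (ord1 j) eqxx andbT => <-.
  by apply: eq_bigr => k _; rewrite mxE.
- move=> j jp; apply/eqP/negPn/negP => /p0min.
  by rewrite leqNgt (leq_trans jp) // pmin.
move=> k; rewrite hp mxE => hk.
(* The existence of [k] beyond [h p0] ensures that the minors at [p0] are among those assumed to
   vanish. *)
have hn : ((h p0).+1 < n.+1)%N by rewrite (leq_trans _ (ltn_ord k)).
have /eqP := hess_block_minors gu (fun f c => minors p0 f c hn) (leqnn p0) hk.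
by rewrite mulf_eq0 (negPf gp0) /= => /eqP.
Qed.

(** [P] is first shrunk to a prime [Q] over [I] that avoids the determinant. The residue field of
    [Q] then carries an invertible matrix on which the minors vanish, and this matrix lies on a
    stratum. *)
Lemma prime_over_saturation (P : Spec Cz) : (forall x, det_saturation x -> P x) ->
  exists2 p, corner h p & forall x, phi p x = 0 -> P x.
Proof.
(* Avoiding [S] means both lying inside [P] and missing the determinant; [S] misses [I] because [P]
   contains the saturation. *)
move=> satP; pose S : set Cz := [set s | exists2 t, ~~ P t & exists k, s = t * \det Z ^+ k].
have [|||Q [IQ QS]] := exists_prime_avoiding (S := S) I0 ID IM.
- by exists 1; [rewrite Spec1|exists 0%N; rewrite mulr1].
- move=> _ _ [t Pt [k ->]] [t' Pt' [k' ->]]; exists (t * t').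
    by rewrite Spec_mul negb_or Pt.
  by exists (k + k')%N; rewrite mulrACA exprD.
- by move=> x Ix [t /negP Pt [k xE]]; apply: Pt; apply: satP; exists k; rewrite mulrC -xE.
have QP x : Q x -> P x.
  move=> Qx; apply/negPn/negP => nPx; apply: (QS _ Qx).
  by exists x => //; exists 0%N; rewrite mulr1.
have Qd : ~~ Q (\det Z).
  apply/negP => Qd; apply: (QS _ Qd); exists 1; first by rewrite Spec1.
  by exists 1%N; rewrite mul1r.
have [K [F FQ]] := residue_field Q.
have gu : map_mx F Z \in unitmx by rewrite unitmxE unitfE det_map_mx FQ.
have [x /IQ|p cp [w sw]] := stratum_of_point gu ((Iminors F).1 _).
  by rewrite -FQ => /eqP.
exists p => // x phix; apply: QP; rewrite -FQ.
pose iota : {rmorphism C -> K} := (F \o @mpolyC (n.+1 * n.+1) C)%FUN.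
by rewrite (rmorph_mxev (iota := iota) (g := map_mx F Z)) // (stratum_mxev_eq0 _ char0 sw).
Qed.

Lemma varmx_neq0 i j : Z i j != 0.
Proof.
apply/eqP => z0; pose id := @idfun C : {rmorphism C -> C}.
have : mxev id (const_mx 1) (Z i j) = 0 by rewrite z0 rmorph0.
by rewrite mxev_var mxE => /eqP; rewrite oner_eq0.
Qed.

(** If [p' < p], the entry [Z 0 p'] lies in the first kernel only. If [p < p'], then [h p < h p'],
    and the Cramer numerator for column [h p'] does the same. *)
Lemma corner_primes_incomparable p p' : corner h p -> corner h p' ->
  (forall x, phi p x = 0 -> phi p' x = 0) -> p = p'.
Proof.
move=> cp cp' sub; apply: val_inj; apply/eqP; rewrite eqn_leq leqNgt [X in _ && X]leqNgt.
apply/andP; split; apply/negP => lt.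
  have row0 r : chart r (h r) Z 0 p' = if (p' < r)%N then 0 else Z 0 p' by rewrite mxE.
  have := sub (Z 0 p'); rewrite !chart_mor_var !row0 lt ltnn => /(_ erefl)/eqP.
  exact/negP/varmx_neq0.
have hlt := corner_ltn cp' lt.
case: (unliftP 0 (h p')) => [a aE|h0]; last by rewrite h0 in hlt.
have aE' : h p' = a.+1 :> nat by rewrite aE.
have ahp : (a < h p)%N = false by rewrite ltnNge -ltnS -aE' hlt.
have := sub (solution_num n C a 0); rewrite !chart_mor_num aE' ltnSn ahp => /(_ erefl)/eqP.
by rewrite mulf_eq0 (negPf (minor_det_neq0 _ _)) (negPf (varmx_neq0 _ _)).
Qed.

Lemma equidimensional_corners (R : realType) (B : comNzRingType)
    (f : {rmorphism Cz -> B}) (g : B -> Cz) :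
  cancel g f -> (forall x, f x = 0 <-> det_saturation x) ->
  equidimensional (Spec B) R <->
  forall p p', corner h p -> corner h p' -> (h p - p = h p' - p')%N.
Proof.
move=> gK fsat.
have dom : prime_idealr_closed (fun x : Cz => x == 0).
  by move=> u v; rewrite /in_mem /= mulf_eq0.
have /choice[P PE] : forall p, exists P : Spec B, forall x, P (f x) = (phi p x == 0).
  move=> p; have [P PE] := kernel_spec (phi p) dom.
  have [x /fsat/det_saturation_chart px|P' P'E] := push_spec (P := P) gK.
    by rewrite PE px.
  by exists P' => x; rewrite P'E PE.
pose J := {p | corner h p}; pose PJ (p : J) := P (sval p).
have Pmin (Q : Spec B) : exists p : J, prime_le (PJ p) Q.
  have [Q' Q'E] := pullback_spec f Q.
  have [x /fsat fx0|p cp pQ] := prime_over_saturation (P := Q').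
    by rewrite Q'E fx0 Spec0.
  exists (exist _ p cp) => b; rewrite -[b]gK PE => /eqP /pQ.
  by rewrite Q'E.
have Pinc (p p' : J) : prime_le (PJ p) (PJ p') -> p = p'.
  case: p p' => [p cp] [p' cp'] le; apply: eq_exist; apply: corner_primes_incomparable => //.
  by move=> x px; apply/eqP; rewrite -PE; apply: le; rewrite PE px.
pose N (p : J) := #|chart_vars (sval p) (h (sval p))|.
have dimN (p : J) : krull_dim R (Vspec (PJ p)) = (N p)%:R%:E.
  case: p => p cp; apply: krull_dim_Vspec => [k Q ch le|].
    have [Q' ch' Q'E] := pullback_chain gK ch.
    have [K KE] := kernel_spec (phi p) dom.
    apply: (prime_chain_chart_le KE ch') => x; rewrite KE Q'E => px.
    by apply: le; rewrite PE.
  have [Q ch kerQ] := prime_chain_chart C p (h p).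
  have [x /fsat/det_saturation_chart px|Q' ch' Q'E] := push_chain gK ch.
    exact: kerQ.
  exists Q' => // b; rewrite -[b]gK PE Q'E => /eqP; exact: kerQ.
rewrite (equidimensional_primes Pmin Pinc dimN).
(* The dimension depends on the corner only through [h p - p]. *)
have NE p (cp : corner h p) : (N (exist _ p cp) + n = n.+1 * n.+1 + (h p - p))%N.
  rewrite -(card_chart_vars p (h p)) /N /= -!addnA; congr (_ + _)%N.
  rewrite [(n - _ + _)%N]addnC addnA subnKC ?hess_ge // subnKC // -ltnS.
  exact: ltn_ord.
split=> [eqN p p' cp cp'|eqh [p cp] [p' cp']].
  have := NE p' cp'; rewrite -(eqN (exist _ p cp)) NE => /eqP.
  by rewrite eqn_add2l => /eqP.
by apply/eqP; rewrite -(eqn_add2r n) !NE (eqh p p').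
Qed.

End HessenbergPrimes.

(** * Saturation without denominators *)

Lemma saturationP (A : idomainType) (d : A) (I : set A) :
  d != 0 -> I 0 -> (forall u v, I u -> I v -> I (u + v)) ->
  (forall a u, I u -> I (a * u)) ->
  forall x, saturation d I x <-> exists k, I (d ^+ k * x).
Proof.
move=> d0 I0 ID IM x; split=> [[t [tI xE]]|[k Ix]]; last first.
  exists [:: ((tofrac d ^+ k)^-1, tofrac (d ^+ k * x))]; split.
    move=> y; rewrite inE => /eqP ->; split; last by exists (d ^+ k * x).
    by exists 1, k; rewrite rmorph1 div1r.
  by rewrite big_seq1 /= rmorphM rmorphXn /= mulKf // expf_neq0 // tofrac_eq0.
(* Induction on the sum brings its terms to a common denominator, a power of [d]. *)
suff [k [a [Ia]]] : exists k a, I a /\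
    tofrac d ^+ k * \sum_(y <- t) y.1 * y.2 = tofrac a.
  rewrite -xE -rmorphXn -rmorphM => /eqP; rewrite tofrac_eq => /eqP e.
  by exists k; rewrite e.
elim: t tI {xE} => [|[u v] t IHt] tI; first by exists 0%N, 0; rewrite big_nil mulr0 rmorph0.
have [y yt|k [a [Ia ka]]] := IHt; first by apply: tI; rewrite inE yt orbT.
have [/= [b [l ->]] [q Iq <-]] := tI _ (mem_head _ _).
exists (k + l)%N, (d ^+ k * b * q + d ^+ l * a); split; first exact: ID (IM _ _ Iq) (IM _ _ Ia).
rewrite big_cons /= mulrDr rmorphD !rmorphM !rmorphXn /= -ka exprD.
congr (_ + _); last by rewrite mulrA [X in X * _ = _]mulrC.
rewrite -!mulrA; congr (_ * _); rewrite mulrCA; congr (_ * _).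
by rewrite mulVKf // expf_neq0 // tofrac_eq0.
Qed.

(** * The ideal of the minimal semisimple scheme *)

Section Instance.
Variables (R : realType) (n : nat) (h : hessenberg n.+1).
Local Notation C := (R[i]).
Local Notation Cz := (mpoly (n.+1 * n.+1) C).
Local Notation Z := (generic_mx R n.+1).
Local Notation s := (minimal_semisimple R n.+1).
Local Notation I := (hess_ideal s h).

Lemma ideal_generated_add (S : set Cz) u v :
  ideal_generated setT S u -> ideal_generated setT S v -> ideal_generated setT S (u + v).
Proof.
move=> [t [tS ->]] [t' [tS' ->]]; exists (t ++ t'); rewrite big_cat; split=> // y.
by rewrite mem_cat => /orP[/tS|/tS'].
Qed.

Lemma ideal_generated_mul (S : set Cz) a u :
  ideal_generated setT S u -> ideal_generated setT S (a * u).
Proof.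
move=> [t [tS ->]]; exists [seq (a * y.1, y.2) | y <- t]; split.
  by move=> _ /mapP[y /tS[_ Sy] ->].
by rewrite big_map mulr_sumr; apply: eq_bigr => y _; rewrite mulrA.
Qed.

Lemma hess_ideal_at0 i : hess_ideal_at s h i 0.
Proof. by rewrite /hess_ideal_at; case: ifP => // _; exists [::]; rewrite big_nil. Qed.

Lemma hess_ideal0 : I 0.
Proof.
by exists (fun=> 0); rewrite big1 //; split=> // i; exact: hess_ideal_at0.
Qed.

Lemma hess_idealD u v : I u -> I v -> I (u + v).
Proof.
move=> [q [qI ->]] [q' [qI' ->]]; exists (fun i => q i + q' i); rewrite big_split.
split=> // i; have := qI i; have := qI' i; rewrite /hess_ideal_at; case: ifP => _.
  by move=> q'i qi; exact: ideal_generated_add.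
by move=> /= -> ->; rewrite addr0.
Qed.

Lemma hess_idealM a u : I u -> I (a * u).
Proof.
move=> [q [qI ->]]; exists (fun i => a * q i); rewrite mulr_sumr.
split=> // i; have := qI i; rewrite /hess_ideal_at; case: ifP => _.
  exact: ideal_generated_mul.
by move=> /= ->; rewrite mulr0.
Qed.

Lemma map_hess_mx (K : fieldType) (F : {rmorphism Cz -> K}) i :
  map_mx F (hess_mx s h i) = hess_block h (map_mx F Z) i.
Proof.
rewrite /hess_mx map_row_mx; congr row_mx; last by rewrite map_mxsub.
apply/matrixP => a j; rewrite mxE mxE map_diag_mx mul_diag_mx !mxE.
rewrite rmorphM !rmorph_nat.
case: (eqVneq a 0) => [->|a0]; first by rewrite mul1r.
by rewrite -[(a == 0%N :> nat)]/(a == 0) (negPf a0) mul0r.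
Qed.

Lemma hess_ideal_minors (K : fieldType) (F : {rmorphism Cz -> K}) :
  (forall x, I x -> F x = 0) <-> minors_vanish h (map_mx F Z).
Proof.
split=> [FI i f c hi fh ch|minors x [q [qI ->]]].
  rewrite -map_hess_mx -map_mxsub det_map_mx; apply: FI.
  set m := \det _; exists (fun k => if k == i then m else 0); split=> [k|].
    case: eqP => [->|_]; last exact: hess_ideal_at0.
    rewrite /hess_ideal_at hi; exists [:: (1, m)]; rewrite big_seq1 mul1r; split=> // y.
    by rewrite inE => /eqP ->; split=> //; exists f, c.
  by rewrite (bigD1 i) //= eqxx big1 ?addr0 // => k /negPf ->.
rewrite rmorph_sum big1 // => i _; have := qI i; rewrite /hess_ideal_at.
case: ifP => [hi [t [tS ->]]|_ /= ->]; last by rewrite rmorph0.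
rewrite rmorph_sum big_seq big1 // => y /tS[_ [f [c [fh ch ->]]]].
rewrite rmorphM -det_map_mx map_mxsub map_hess_mx.
by rewrite (minors i f c hi fh ch) mulr0.
Qed.

Lemma det_generic_neq0 : \det Z != 0.
Proof.
pose id := @idfun C : {rmorphism C -> C}.
apply/eqP => d0; have := mxev_det id (1%:M : 'M[C]_n.+1); rewrite det1 => d1.
have : mxev id 1%:M (\det Z) = 1 by [].
by rewrite d0 rmorph0 => /eqP; rewrite eq_sym oner_eq0.
Qed.

Lemma hess_sat_idealE x : hess_sat_ideal s h x <-> det_saturation I x.
Proof.
have satE := saturationP det_generic_neq0 hess_ideal0 hess_idealD hess_idealM x.
by split=> [/asboolP/satE//|/satE satx]; apply/asboolP.
Qed.

Lemma equidimensional_hess :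
  equidimensional (matrix_hessenberg_scheme s h) R <->
  forall p p', corner h p -> corner h p' -> (h p - p = h p' - p')%N.
Proof.
pose B : comNzRingType := {ideal_quot (hess_sat_ideal s h)}.
have char0 : [pchar C] =i pred0 by exact: pchar_num.
have gK : cancel (@repr _ B) (\pi_B : {rmorphism Cz -> B}) by exact: reprK.
apply: (equidimensional_corners char0 hess_ideal0 hess_idealD hess_idealM
  hess_ideal_minors R gK) => x.
have -> : (0 : B) = \pi_B 0 by exact/esym/(rmorph0 (\pi_B : {rmorphism Cz -> B})).
rewrite -hess_sat_idealE; split=> [/eqP|xI]; last apply/eqP.
  by rewrite -Quotient.idealrBE subr0.
by rewrite -Quotient.idealrBE subr0.
Qed.

End Instance.

Theorem corollary4p5 (R : realType) (n : nat) (n_gt0 : (0 < n)%N)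
    (h : hessenberg n) :
  (equidimensional (matrix_hessenberg_scheme (minimal_semisimple R n) h) R <->
     exists c : int, forall i : 'I_n,
       corner h i -> subdiagonal c (corner_box h i)) /\
  (equidimensional (matrix_hessenberg_scheme (minimal_semisimple R n) h) R <->
     forall i j : 'I_n, corner h i -> corner h j -> i <> j ->
       (h i : nat)%:Z - (i : nat)%:Z = (h j : nat)%:Z - (j : nat)%:Z).
Proof.
case: n n_gt0 h => // n _ h; rewrite equidimensional_hess.
(* Counting from 0 shifts [h i] and [i] alike, and [i <= h i] makes truncated subtraction exact. *)
have subE (i : 'I_n.+1) : (h i : nat)%:Z - (i : nat)%:Z = (h i - i)%N.
  by rewrite subzn // hess_ge.
split; split=> [eqh|].
(* Index 0 is always a corner, so its subdiagonal is the only candidate. *)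
- exists (h 0)%:Z => i ci; rewrite /subdiagonal /= subE.
  by rewrite (eqh i 0) ?subn0 // => j.
- by move=> [c hc] p p' /hc + /hc; rewrite /subdiagonal /= !subE => <- [].
- by move=> i j ci cj _; rewrite !subE (eqh i j).
move=> eqh i j ci cj; have [->//|/eqP ij] := eqVneq i j.
by have := eqh i j ci cj ij; rewrite !subE => -[].
Qed.
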